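(* Let $d\ge 1$ and let $A\subset\mathbb{T}^d$ be a closed set. Write $\psi=\overline{\dim}_M(\partial A)$. (i) Suppose $\mu(A)\notin\mathbb{Q}$ and $\mu(A)$ is approximable from below to order $k$, where $k\ge 1$. Then for Lebesgue-almost every $\alpha\in\mathbb{T}^d$, \[\underline{\dim}_M\big(H(A,\alpha)\big)\le \psi+\frac{d-\psi}{k}.\] (ii) Suppose $\mu(A)\in\mathbb{Q}$. Then for Lebesgue-almost every $\alpha\in\mathbb{T}^d$, \[\underline{\dim}_M\big(H(A,\alpha)\big)\le \psi.\]
   Context: $\mathbb{T}^d=\mathbb{R}^d/\mathbb{Z}^d$ with its standard quotient (translation-invariant) metric $|\cdot|$, and $\mu$ denotes Lebesgue (Haar) measure on $\mathbb{T}^d$, normalized so that $\mu(\mathbb{T}^d)=1$. $\chi_A$ is the indicator function of $A$. For $\alpha\in\mathbb{T}^d$, the strictly heavy set of $A$ with respect to rotation by $\alpha$ is \[H(A,\alpha)=\Big\{x\in\mathbb{T}^d:\ \sum_{i=0}^{n-1}\big(\chi_A(x+i\alpha \bmod 1)-\mu(A)\big)>0\ \text{for all } n\in\mathbb{N}\Big\}.\] For $S\subset\mathbb{T}^d$ and $\epsilon>0$, the packing number $N_S(\epsilon)$ is the maximal cardinality of a finite subset of $S$ whose points are pairwise at distance at least $2\epsilon$. The upper and lower Minkowski dimensions are $\overline{\dim}_M(S)=\limsup_{\epsilon\to0}\frac{\log N_S(\epsilon)}{-\log\epsilon}$ and $\underline{\dim}_M(S)=\liminf_{\epsilon\to0}\frac{\log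 N_S(\epsilon)}{-\log\epsilon}$ (with the conclusion understood as trivially true if $H(A,\alpha)=\emptyset$). $\partial A$ is the topological boundary of $A$. A real number $\gamma$ is approximable from below to order $k$ if there exist a constant $c>0$ and an infinite sequence of distinct rationals $p_i/q_i$ ($q_i$ positive integers) with $0\le \gamma-\frac{p_i}{q_i}<\frac{c}{q_i^k}$ for all $i$. *)

(* Defs.v *)
From Stdlib Require Import Reals Lra List ClassicalEpsilon.
Open Scope R_scope.

(* Points of T^d: canonical representatives x : nat -> R with
   0 <= x i < 1 for i < d and x i = 0 for i >= d. *)
Definition point := nat -> R.

Definition in_torus (d : nat) (x : point) : Prop :=
  (forall i, (i < d)%nat -> 0 <= x i < 1) /\ (forall i, (d <= i)%nat -> x i = 0).

(* fractional part: up r - 1 = floor r *)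
Definition frac (r : R) : R := r - (IZR (up r) - 1).

Definition sumd (n : nat) (g : nat -> R) : R := fold_right Rplus 0 (map g (seq 0 n)).
Definition prodd (n : nat) (g : nat -> R) : R := fold_right Rmult 1 (map g (seq 0 n)).

Definition tadd (d : nat) (x y : point) : point :=
  fun i => if Nat.ltb i d then frac (x i + y i) else 0.

Definition tdist (d : nat) (x y : point) : R :=
  sqrt (sumd d (fun i => Rsqr (Rmin (frac (x i - y i)) (1 - frac (x i - y i))))).

Definition indicator (A : point -> Prop) (x : point) : R :=
  if excluded_middle_informative (A x) then 1 else 0.

Definition in_box (d : nat) (a b : point) (x : point) : Prop :=
  forall i, (i < d)%nat -> a i <= x i <= b i.

Definition box_vol (d : nat) (a b : point) : R := prodd d (fun i => Rmax 0 (b i - a i)).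

Definition cover_bound (d : nat) (X : point -> Prop) (s : R) : Prop :=
  exists a b : nat -> point,
    (forall x, X x -> exists n, in_box d (a n) (b n) x) /\
    (forall N, sumd N (fun n => box_vol d (a n) (b n)) <= s).

(* m is the Lebesgue outer measure of X (= its measure when X is measurable) *)
Definition lebesgue_measure_is (d : nat) (X : point -> Prop) (m : R) : Prop :=
  (forall s, cover_bound d X s -> m <= s) /\
  (forall m', (forall s, cover_bound d X s -> m' <= s) -> m' <= m).

Definition null_set (d : nat) (X : point -> Prop) : Prop :=
  forall eps, 0 < eps -> cover_bound d X eps.

Definition almost_every (d : nat) (P : point -> Prop) : Prop :=
  exists N, null_set d N /\ forall alpha, in_torus d alpha -> ~ N alpha -> P alpha.

Definition torus_closed (d : nat) (A : point -> Prop) : Prop :=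
  forall x, in_torus d x -> (forall r, 0 < r -> exists y, A y /\ tdist d x y < r) -> A x.

Definition torus_boundary (d : nat) (A : point -> Prop) (x : point) : Prop :=
  in_torus d x /\
  forall r, 0 < r ->
    (exists y, in_torus d y /\ A y /\ tdist d x y < r) /\
    (exists z, in_torus d z /\ ~ A z /\ tdist d x z < r).

Definition orbit (d : nat) (alpha x : point) (i : nat) : point :=
  Nat.iter i (fun y => tadd d y alpha) x.

Definition heavy_set (d : nat) (A : point -> Prop) (muA : R) (alpha : point)
  (x : point) : Prop :=
  in_torus d x /\
  forall n, (1 <= n)%nat ->
    sumd n (fun i => indicator A (orbit d alpha x i) - muA) > 0.

Definition packing_ge (d : nat) (X : point -> Prop) (e : R) (n : nat) : Prop :=
  exists l : list point, length l = n /\ (forall x, In x l -> X x) /\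
    forall i j, (i < n)%nat -> (j < n)%nat -> i <> j ->
      tdist d (nth i l (fun _ => 0)) (nth j l (fun _ => 0)) >= 2 * e.

Definition packing_number (d : nat) (X : point -> Prop) (e : R) (n : nat) : Prop :=
  packing_ge d X e n /\ ~ packing_ge d X e (S n).

Definition mink_ratio (n : nat) (e : R) : R := ln (INR n) / (- ln e).

Definition upper_Mdim_is (d : nat) (X : point -> Prop) (psi : R) : Prop :=
  (forall delta, 0 < delta -> exists eta, 0 < eta /\
     forall e n, 0 < e < eta -> e < 1 -> packing_number d X e n ->
       mink_ratio n e <= psi + delta) /\
  (forall delta eta, 0 < delta -> 0 < eta -> exists e n,
     0 < e < eta /\ e < 1 /\ packing_number d X e n /\ psi - delta <= mink_ratio n e).

Definition lower_Mdim_le (d : nat) (X : point -> Prop) (c : R) : Prop :=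
  forall delta eta, 0 < delta -> 0 < eta -> exists e n,
    0 < e < eta /\ e < 1 /\ packing_number d X e n /\ mink_ratio n e <= c + delta.

Definition lower_Mdim_bound (d : nat) (X : point -> Prop) (c : R) : Prop :=
  (forall x, ~ X x) \/ lower_Mdim_le d X c.

Definition is_rational (r : R) : Prop :=
  exists (p : Z) (q : nat), (0 < q)%nat /\ r = IZR p / INR q.

Definition approximable_below (gamma k : R) : Prop :=
  exists c, 0 < c /\ exists (p : nat -> Z) (q : nat -> nat),
    (forall i, (0 < q i)%nat) /\
    (forall i j, i <> j -> IZR (p i) / INR (q i) <> IZR (p j) / INR (q j)) /\
    (forall i, 0 <= gamma - IZR (p i) / INR (q i) < c / Rpower (INR (q i)) k).

(* Main.v *)
(** Let [e] be a scale and let [A+] be the [e/2d]-neighbourhood of [A].  Every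
    point close to a strictly heavy point for [A] is strictly heavy for [A+].
    If [p/q <= mu(A)], then along an orbit the integers [W i = q S+_i - p i],
    where [S+] counts the visits to [A+], strictly increase through the times at
    which the orbit is close to [H(A,alpha)]; hence these times have frequency at
    most the drift [q (mu(A+) - p/q)].  If the orbit is equidistributed, then [M]
    points of [H(A,alpha)] separated at scale [e] produce such times with
    frequency of order [M e^d], while [mu(A+) <= mu(A) + O(e^(d - psi - delta))]
    by definition of [psi].  So
      [M <= O(1) q (e^(-d) (mu(A) - p/q) + e^(-psi - delta))],
    and one takes [q] fixed in the rational case and [e = q^(-k / (d - psi))] in
    the other one.  Equidistribution follows from density of the orbit of
    [alpha], and almost every [alpha] has a dense orbit, because almost every
    [alpha] has every digit vector in every base [L]. *)

Require Import Defs.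
From Stdlib Require Import Reals Lra Lia List ZArith Classical ClassicalEpsilon Cantor FinFun.
From Coquelicot Require Compactness.
Open Scope R_scope.

(** * Finite sums and products *)

(** Strict heaviness constrains all times at once, so no finite stretch of an orbit certifies it. It
    is used only through differences [W j - W i] where at time [i] the orbit is close to a heavy
    point: the orbit restarted at time [i] shadows that point, and integrality turns the strict
    positivity of the difference into a gap of 1. This is why [mu(A)] is replaced by a rational
    below it, and why the bound pays the factor [q]. As the orbit is restarted at arbitrary times,
    visit frequencies need an error term uniform in the starting point; density provides it by
    comparing a cube with its translates by the points of order [L]. Measure enters through finitely
    many cubes: a box cover of nearly minimal volume is refined into cubes and made finite by
    compactness. *)

Definition lsum {T : Type} (f : T -> R) (l : list T) : R :=
  fold_right Rplus 0 (map f l).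

Lemma lsum_app {T} (f : T -> R) l1 l2 : lsum f (l1 ++ l2) = lsum f l1 + lsum f l2.
Proof.
unfold lsum; induction l1 as [|x l1 IH]; simpl; [ring|rewrite IH; ring].
Qed.

Lemma lsum_cons {T} (f : T -> R) x l : lsum f (x :: l) = f x + lsum f l.
Proof. reflexivity. Qed.

Lemma lsum_le {T} (f g : T -> R) l :
  (forall x, In x l -> f x <= g x) -> lsum f l <= lsum g l.
Proof.
induction l as [|x l IH]; intros H; [apply Rle_refl|].
rewrite !lsum_cons; apply Rplus_le_compat; [apply H; now left|].
apply IH; intros y Hy; apply H; now right.
Qed.

Lemma lsum_ext {T} (f g : T -> R) l :
  (forall x, In x l -> f x = g x) -> lsum f l = lsum g l.
Proof.
intros H; apply Rle_antisym; apply lsum_le; intros x Hx; rewrite (H x Hx); lra.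
Qed.

Lemma lsum_ge0 {T} (f : T -> R) l : (forall x, In x l -> 0 <= f x) -> 0 <= lsum f l.
Proof.
induction l as [|x l IH]; intros H; [apply Rle_refl|].
rewrite lsum_cons; apply Rplus_le_le_0_compat; [apply H; now left|].
apply IH; intros y Hy; apply H; now right.
Qed.

Lemma lsum_ge_term {T} (f : T -> R) l x :
  (forall y, In y l -> 0 <= f y) -> In x l -> f x <= lsum f l.
Proof.
induction l as [|y l IH]; intros H Hx; [easy|].
rewrite lsum_cons; destruct Hx as [->|Hx].
- assert (0 <= lsum f l); [|lra].
  apply lsum_ge0; intros z Hz; apply H; now right.
- assert (0 <= f y) by (apply H; now left).
  assert (f x <= lsum f l); [|lra].
  apply IH; [intros z Hz; apply H; now right|easy].
Qed.

Lemma lsum_plus {T} (f g : T -> R) l :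
  lsum (fun x => f x + g x) l = lsum f l + lsum g l.
Proof.
induction l as [|x l IH]; [unfold lsum; simpl; ring|].
rewrite !lsum_cons, IH; ring.
Qed.

Lemma lsum_scal {T} c (f : T -> R) l : lsum (fun x => c * f x) l = c * lsum f l.
Proof.
induction l as [|x l IH]; [unfold lsum; simpl; ring|].
rewrite !lsum_cons, IH; ring.
Qed.

Lemma lsum_const {T} c (l : list T) : lsum (fun _ => c) l = INR (length l) * c.
Proof.
induction l as [|x l IH]; [unfold lsum; simpl; ring|].
rewrite lsum_cons, IH; cbn [length]; rewrite S_INR; ring.
Qed.

Lemma lsum_swap {T U} (f : T -> U -> R) l m :
  lsum (fun x => lsum (f x) m) l = lsum (fun y => lsum (fun x => f x y) l) m.
Proof.
induction l as [|x l IH].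
- transitivity (lsum (fun _ : U => 0) m); [|now apply lsum_ext].
  rewrite lsum_const; unfold lsum; simpl; ring.
- rewrite lsum_cons, IH, <- lsum_plus; reflexivity.
Qed.

Lemma lsum_map {T U} (f : U -> R) (h : T -> U) l :
  lsum f (map h l) = lsum (fun x => f (h x)) l.
Proof. unfold lsum; now rewrite map_map. Qed.

Lemma lsum_flat_map {T U} (f : U -> R) (h : T -> list U) l :
  lsum f (flat_map h l) = lsum (fun x => lsum f (h x)) l.
Proof.
induction l as [|x l IH]; [reflexivity|].
simpl flat_map; now rewrite lsum_app, lsum_cons, IH.
Qed.

Lemma sumd_S n g : sumd (S n) g = sumd n g + g n.
Proof.
unfold sumd; rewrite seq_S; fold (lsum g (seq 0 n ++ (0 + n)%nat :: nil)).
rewrite lsum_app; unfold lsum; simpl; ring.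
Qed.

Lemma sumd_lsum n g : sumd n g = lsum g (seq 0 n).
Proof. reflexivity. Qed.

Lemma lsum_sumd {T} (f : T -> nat -> R) n l :
  lsum (fun x => sumd n (f x)) l = sumd n (fun t => lsum (fun x => f x t) l).
Proof. apply lsum_swap. Qed.

Lemma sumd_swap (f : nat -> nat -> R) n m :
  sumd n (fun i => sumd m (f i)) = sumd m (fun j => sumd n (fun i => f i j)).
Proof. apply lsum_swap. Qed.

Lemma sumd_le n f g : (forall i, (i < n)%nat -> f i <= g i) -> sumd n f <= sumd n g.
Proof.
intros H; apply lsum_le; intros x Hx; apply H; apply in_seq in Hx; lia.
Qed.

Lemma sumd_ext n f g : (forall i, (i < n)%nat -> f i = g i) -> sumd n f = sumd n g.
Proof.
intros H; apply lsum_ext; intros x Hx; apply H; apply in_seq in Hx; lia.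
Qed.

Lemma sumd_ge0 n f : (forall i, (i < n)%nat -> 0 <= f i) -> 0 <= sumd n f.
Proof.
intros H; apply lsum_ge0; intros x Hx; apply H; apply in_seq in Hx; lia.
Qed.

Lemma sumd_ge_term n f i :
  (forall j, (j < n)%nat -> 0 <= f j) -> (i < n)%nat -> f i <= sumd n f.
Proof.
intros H Hi; apply (lsum_ge_term f (seq 0 n) i).
- intros y Hy; apply H; apply in_seq in Hy; lia.
- apply in_seq; lia.
Qed.

Lemma sumd_const n c : sumd n (fun _ => c) = INR n * c.
Proof.
rewrite sumd_lsum, lsum_const, length_seq; reflexivity.
Qed.

Lemma sumd_add n m g : sumd (n + m) g = sumd n g + sumd m (fun i => g (n + i)%nat).
Proof.
induction m as [|m IH].
- rewrite Nat.add_0_r; unfold sumd at 3; simpl; ring.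
- rewrite Nat.add_succ_r, !sumd_S, IH; ring.
Qed.

Lemma sumd_le_index n m g :
  (forall i, 0 <= g i) -> (n <= m)%nat -> sumd n g <= sumd m g.
Proof.
intros H Hnm; replace m with (n + (m - n))%nat by lia; rewrite sumd_add.
assert (0 <= sumd (m - n) (fun i => g (n + i)%nat)) by (apply sumd_ge0; auto).
lra.
Qed.

Lemma prodd_S n g : prodd (S n) g = prodd n g * g n.
Proof.
unfold prodd; rewrite seq_S, map_app, fold_right_app; simpl.
assert (E : forall c l, fold_right Rmult c (map g l) = fold_right Rmult 1 (map g l) * c).
{ intros c l; induction l as [|x l IH]; simpl; [ring|rewrite IH; ring]. }
rewrite E; ring.
Qed.

Lemma prodd_ext n f g : (forall i, (i < n)%nat -> f i = g i) -> prodd n f = prodd n g.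
Proof.
induction n as [|n IH]; intros H; [reflexivity|].
rewrite !prodd_S, IH, H; auto with arith.
Qed.

Lemma prodd_ge0 n g : (forall i, (i < n)%nat -> 0 <= g i) -> 0 <= prodd n g.
Proof.
induction n as [|n IH]; intros H; [unfold prodd; simpl; lra|].
rewrite prodd_S; apply Rmult_le_pos; auto with arith.
Qed.

Lemma prodd_le n f g :
  (forall i, (i < n)%nat -> 0 <= f i <= g i) -> prodd n f <= prodd n g.
Proof.
induction n as [|n IH]; intros H; [unfold prodd; simpl; lra|].
rewrite !prodd_S; apply Rmult_le_compat.
- apply prodd_ge0; intros i Hi; apply H; lia.
- apply H; lia.
- apply IH; auto with arith.
- apply H; lia.
Qed.

Lemma prodd_const n c : prodd n (fun _ => c) = c ^ n.
Proof.
induction n as [|n IH]; [reflexivity|rewrite prodd_S, IH; simpl; ring].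
Qed.

Lemma prodd_scal n c g : prodd n (fun i => c * g i) = c ^ n * prodd n g.
Proof.
induction n as [|n IH]; [unfold prodd; simpl; ring|].
rewrite !prodd_S, IH; simpl; ring.
Qed.

(** Continuity of a product at [t = 0], in the form met in [box_cubes]: [l i * (L + 1) + 1] cells,
    each counted [/ L], give the factor [l i + (l i + 1) * t] with [t = / L]. *)
Lemma prodd_perturb n l eps :
  (forall i, 0 <= l i) -> 0 < eps ->
  exists t0, 0 < t0 /\ forall t, 0 <= t <= t0 ->
    prodd n (fun i => l i + (l i + 1) * t) <= prodd n l + eps.
Proof.
intros Hl; revert eps; induction n as [|n IH]; intros eps He.
- exists 1; split; [lra|]; intros; unfold prodd; simpl; lra.
- set (c := l n + (l n + 1)).
  assert (Hc : 0 < c) by (unfold c; specialize (Hl n); lra).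
  destruct (IH (eps / 2 / c)) as [t0 [Ht0 H]]; [apply Rdiv_lt_0_compat; lra|].
  set (P := prodd n l).
  assert (HP : 0 <= P) by (apply prodd_ge0; auto).
  (* Half of [eps] pays for the last factor, half for the others; [P + 1] keeps the denominator
     positive when [P = 0]. *)
  set (u := eps / 2 / ((P + 1) * c)).
  assert (Hu : 0 < u).
  { unfold u; apply Rdiv_lt_0_compat; [lra|]; apply Rmult_lt_0_compat; lra. }
  exists (Rmin 1 (Rmin t0 u)); split.
  { repeat apply Rmin_glb_lt; lra. }
  intros t [Ht Ht'].
  assert (t <= 1 /\ t <= t0 /\ t <= u) as (H1 & H2 & H3).
  { repeat split; eapply Rle_trans; try exact Ht'.
    - apply Rmin_l.
    - eapply Rle_trans; [apply Rmin_r|apply Rmin_l].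
    - eapply Rle_trans; [apply Rmin_r|apply Rmin_r]. }
  rewrite !prodd_S; specialize (H t (conj Ht H2)); fold P in H |- *.
  assert (Hn := Hl n).
  assert (Hb : 0 <= l n + (l n + 1) * t <= c) by (unfold c; nra).
  eapply Rle_trans; [apply Rmult_le_compat_r; [apply Hb|apply H]|].
  assert (E1 : eps / 2 / c * (l n + (l n + 1) * t) <= eps / 2).
  { apply Rle_trans with (eps / 2 / c * c); [|right; field; lra].
    apply Rmult_le_compat_l; [apply Rlt_le, Rdiv_lt_0_compat; lra|apply Hb]. }
  assert (E2 : P * ((l n + 1) * t) <= eps / 2).
  { apply Rle_trans with ((P + 1) * (c * u)).
    - apply Rmult_le_compat; try nra. unfold c; nra.
    - right; unfold u; field; lra. }
  nra.
Qed.

(** * Distance to the nearest integer *)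

Definition nrm (t : R) : R := Rmin (frac t) (1 - frac t).

Lemma frac_bound t : 0 <= frac t < 1.
Proof. unfold frac; destruct (archimed t); lra. Qed.

Lemma frac_eq t : exists z, frac t = t + IZR z.
Proof. exists (1 - up t)%Z; unfold frac; rewrite minus_IZR; ring. Qed.

Lemma nrm_le t z : nrm t <= Rabs (t + IZR z).
Proof.
unfold nrm; destruct (frac_eq t) as [w Hw]; assert (Hb := frac_bound t).
replace (t + IZR z) with (frac t + IZR (z - w)) by (rewrite minus_IZR; lra).
destruct (Z_le_gt_dec 0 (z - w)) as [H|H].
- apply IZR_le in H; rewrite Rabs_right by lra.
  eapply Rle_trans; [apply Rmin_l|lra].
- assert (H' : (z - w <= -1)%Z) by lia; apply IZR_le in H'.
  rewrite Rabs_left1 by lra; eapply Rle_trans; [apply Rmin_r|lra].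
Qed.

Lemma nrm_ex t : exists z, nrm t = Rabs (t + IZR z).
Proof.
destruct (frac_eq t) as [w Hw]; assert (Hb := frac_bound t).
unfold nrm, Rmin; destruct Rle_dec.
- exists w; rewrite <- Hw, Rabs_right; lra.
- exists (w - 1)%Z; rewrite minus_IZR, Rabs_left1; lra.
Qed.

Lemma nrm_le_abs t : nrm t <= Rabs t.
Proof. rewrite <- (Rplus_0_r t) at 2; apply (nrm_le t 0). Qed.

Lemma nrm_ge0 t : 0 <= nrm t.
Proof. destruct (nrm_ex t) as [z ->]; apply Rabs_pos. Qed.

Lemma nrm_add s t : nrm (s + t) <= nrm s + nrm t.
Proof.
destruct (nrm_ex s) as [z ->], (nrm_ex t) as [w ->].
eapply Rle_trans; [apply (nrm_le _ (z + w))|].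
rewrite plus_IZR; eapply Rle_trans; [|apply Rabs_triang]; right; f_equal; ring.
Qed.

Lemma nrm_opp t : nrm (- t) = nrm t.
Proof.
assert (H : forall s, nrm (- s) <= nrm s).
{ intros s; destruct (nrm_ex s) as [z ->].
  eapply Rle_trans; [apply (nrm_le _ (- z))|].
  rewrite opp_IZR, <- Rabs_Ropp; right; f_equal; ring. }
apply Rle_antisym; [apply H|]; rewrite <- (Ropp_involutive t) at 1; apply H.
Qed.

Lemma nrm_sym s t : nrm (s - t) = nrm (t - s).
Proof. rewrite <- nrm_opp; f_equal; ring. Qed.

Lemma nrm_shift t z : nrm (t + IZR z) = nrm t.
Proof.
assert (H : forall s w, nrm (s + IZR w) <= nrm s).
{ intros s w; eapply Rle_trans; [apply nrm_add|].
  assert (nrm (IZR w) <= 0); [|lra].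
  eapply Rle_trans; [apply (nrm_le _ (- w))|].
  rewrite opp_IZR, Rplus_opp_r, Rabs_R0; lra. }
apply Rle_antisym; [apply H|].
replace t with (t + IZR z + IZR (- z)) at 1 by (rewrite opp_IZR; ring); apply H.
Qed.

Lemma nrm_eq_mod s t z : s = t + IZR z -> nrm s = nrm t.
Proof. intros ->; apply nrm_shift. Qed.

Lemma nrm_tri a b c : nrm (a - c) <= nrm (a - b) + nrm (b - c).
Proof. replace (a - c) with (a - b + (b - c)) by ring; apply nrm_add. Qed.

(** [L] times the difference of two grid points is an integer, also modulo 1, and it is divisible by
    [L] only if the points coincide. *)
Lemma grid_unique L t r b c :
  2 * r < / INR L -> (b < L)%nat -> (c < L)%nat ->
  nrm (t - INR b / INR L) <= r -> nrm (t - INR c / INR L) <= r -> b = c.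
Proof.
intros Hr Hb Hc H1 H2.
assert (HL : 0 < INR L) by (apply lt_0_INR; lia).
assert (H : nrm (INR b / INR L - INR c / INR L) < / INR L).
{ eapply Rle_lt_trans; [apply (nrm_tri _ t)|]; rewrite (nrm_sym _ t); lra. }
destruct (nrm_ex (INR b / INR L - INR c / INR L)) as [z Hz]; rewrite Hz in H.
assert (H' : Rabs (IZR (Z.of_nat b - Z.of_nat c + z * Z.of_nat L)) < 1).
{ rewrite plus_IZR, minus_IZR, mult_IZR, <- !INR_IZR_INZ.
  replace (INR b - INR c + IZR z * INR L)
    with (INR L * (INR b / INR L - INR c / INR L + IZR z)) by (field; lra).
  rewrite Rabs_mult, (Rabs_right (INR L)) by lra.
  apply Rmult_lt_reg_l with (/ INR L); [now apply Rinv_0_lt_compat|].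
  rewrite <- Rmult_assoc, Rinv_l, Rmult_1_l, Rmult_1_r by lra; exact H. }
rewrite <- abs_IZR in H'; apply lt_IZR in H'.
assert (H0 : (Z.of_nat b - Z.of_nat c + z * Z.of_nat L = 0)%Z) by lia.
assert (z = 0)%Z by nia.
subst z; lia.
Qed.

Lemma floor_ex t : exists z, IZR z <= t < IZR z + 1.
Proof. exists (up t - 1)%Z; rewrite minus_IZR; destruct (archimed t); lra. Qed.

Lemma grid_cover L t :
  (1 <= L)%nat -> exists b, (b < L)%nat /\ nrm (t - INR b / INR L) <= / (2 * INR L).
Proof.
intros HL; assert (HL' : 0 < INR L) by (apply lt_0_INR; lia).
destruct (floor_ex (INR L * t + / 2)) as [z Hz].
assert (Hm := Z.mod_pos_bound z (Z.of_nat L) ltac:(lia)).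
exists (Z.to_nat (z mod Z.of_nat L)); split; [lia|].
rewrite INR_IZR_INZ, Z2Nat.id by lia.
eapply Rle_trans; [apply (nrm_le _ (- (z / Z.of_nat L)))|].
rewrite opp_IZR.
assert (E : IZR z = INR L * IZR (z / Z.of_nat L) + IZR (z mod Z.of_nat L)).
{ rewrite (INR_IZR_INZ L), <- mult_IZR, <- plus_IZR; f_equal; apply Z.div_mod; lia. }
apply Rmult_le_reg_l with (INR L); [easy|].
replace (INR L * / (2 * INR L)) with (/ 2) by (field; lra).
rewrite <- (Rabs_right (INR L)) at 1 by lra; rewrite <- Rabs_mult.
apply Rabs_le.
replace (INR L * (t - IZR (z mod Z.of_nat L) / INR L + - IZR (z / Z.of_nat L)))
  with (INR L * t - (INR L * IZR (z / Z.of_nat L) + IZR (z mod Z.of_nat L)))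
  by (field; lra).
rewrite <- E; lra.
Qed.

(** * Indicators, cubes and product grids *)

Definition chi (P : Prop) : R := if excluded_middle_informative P then 1 else 0.

Lemma chi_1 (P : Prop) : P -> chi P = 1.
Proof. unfold chi; destruct excluded_middle_informative; tauto. Qed.

Lemma chi_0 (P : Prop) : ~ P -> chi P = 0.
Proof. unfold chi; destruct excluded_middle_informative; tauto. Qed.

Lemma chi_bound (P : Prop) : 0 <= chi P <= 1.
Proof. unfold chi; destruct excluded_middle_informative; lra. Qed.

Lemma chi_le (P Q : Prop) : (P -> Q) -> chi P <= chi Q.
Proof. unfold chi; do 2 destruct excluded_middle_informative; intros; tauto || lra. Qed.

Lemma sumd_chi_le1 n (P : nat -> Prop) :
  (forall i j, (i < n)%nat -> (j < n)%nat -> P i -> P j -> i = j) ->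
  sumd n (fun i => chi (P i)) <= 1.
Proof.
induction n as [|n IH]; intros H; [unfold sumd; simpl; lra|].
rewrite sumd_S; destruct (classic (P n)) as [Hn|Hn].
- assert (E : sumd n (fun i => chi (P i)) = sumd n (fun _ => 0)).
  { apply sumd_ext; intros i Hi; apply chi_0; intros Hp.
    specialize (H i n); lia || (assert (i = n) by (apply H; auto with arith); lia). }
  rewrite E, sumd_const, chi_1 by easy; lra.
- rewrite chi_0 by easy; rewrite Rplus_0_r; apply IH; auto with arith.
Qed.

(* Sup-norm distance on the torus, evaluated on arbitrary real lifts. *)
Definition near (d : nat) (r : R) (y c : point) : Prop :=
  forall i, (i < d)%nat -> nrm (y i - c i) <= r.

Lemma near_tri d r s x y z : near d r x y -> near d s y z -> near d (r + s) x z.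
Proof.
intros H1 H2 i Hi; eapply Rle_trans; [apply (nrm_tri _ (y i))|].
specialize (H1 i Hi); specialize (H2 i Hi); lra.
Qed.

Lemma near_sym d r x y : near d r x y -> near d r y x.
Proof. intros H i Hi; rewrite nrm_sym; auto. Qed.

Lemma near_le d r s x y : r <= s -> near d r x y -> near d s x y.
Proof. intros Hrs H i Hi; specialize (H i Hi); lra. Qed.

Fixpoint grid (n : nat) (F : nat -> list R) : list point :=
  match n with
  | O => (fun _ => 0) :: nil
  | S n => flat_map (fun p : point =>
             map (fun v i => if Nat.eqb i n then v else p i) (F n)) (grid n F)
  end.

(** Distributivity. It counts a product grid, and reduces sums of indicators of cubes to one
    coordinate. *)
Lemma grid_sum_prod n F (g : nat -> R -> R) :
  lsum (fun p => prodd n (fun i => g i (p i))) (grid n F) =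
  prodd n (fun i => lsum (g i) (F i)).
Proof.
induction n as [|n IH]; [unfold lsum, prodd; simpl; ring|].
simpl grid; rewrite lsum_flat_map, prodd_S, <- IH.
rewrite Rmult_comm, <- lsum_scal; apply lsum_ext; intros p _.
rewrite lsum_map, Rmult_comm, <- lsum_scal; apply lsum_ext; intros v _.
rewrite prodd_S, Nat.eqb_refl; f_equal; apply prodd_ext; intros i Hi.
destruct (Nat.eqb_spec i n); [lia|easy].
Qed.

Lemma grid_length n F : INR (length (grid n F)) = prodd n (fun i => INR (length (F i))).
Proof.
assert (H := grid_sum_prod n F (fun _ _ => 1)).
cbv beta in H; rewrite prodd_const, pow1, lsum_const, Rmult_1_r in H.
etransitivity; [exact H|].
apply prodd_ext; intros i _; rewrite lsum_const; ring.
Qed.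

(** Agreement is asked on the first [n] coordinates only, since points are functions. *)
Lemma grid_In n F (f : nat -> R) :
  (forall i, (i < n)%nat -> In (f i) (F i)) ->
  exists p, In p (grid n F) /\ forall i, (i < n)%nat -> p i = f i.
Proof.
induction n as [|n IH]; intros H.
- exists (fun _ => 0); split; [now left|lia].
- destruct IH as [p [Hp Hpf]]; [auto with arith|].
  exists (fun i => if Nat.eqb i n then f n else p i); split.
  + simpl; apply in_flat_map; exists p; split; [easy|].
    apply in_map_iff; exists (f n); split; [easy|]; apply H; lia.
  + intros i Hi; destruct (Nat.eqb_spec i n) as [->|]; [easy|apply Hpf; lia].
Qed.

Lemma chi_forall_prodd n (P : nat -> Prop) :
  chi (forall i, (i < n)%nat -> P i) = prodd n (fun i => chi (P i)).
Proof.
induction n as [|n IH]; [apply chi_1; lia|].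
rewrite prodd_S, <- IH; destruct (classic (forall i, (i < n)%nat -> P i)) as [H|H].
- rewrite (chi_1 _ H), Rmult_1_l; destruct (classic (P n)) as [Hn|Hn].
  + rewrite !chi_1; [easy|easy|]; intros i Hi.
    destruct (Nat.eq_dec i n) as [->|]; [easy|apply H; lia].
  + rewrite !chi_0; [easy|easy|]; intros H'; apply Hn, H'; lia.
- rewrite (chi_0 _ H), Rmult_0_l; apply chi_0; intros H'; apply H.
  intros i Hi; apply H'; lia.
Qed.

(** The subgroup of points of order dividing [L]; the translates by it of a cube of side [/ L] tile
    the torus. *)
Definition lattice (d L : nat) : list point :=
  grid d (fun _ => map (fun b => INR b / INR L) (seq 0 L)).

Lemma lattice_length d L : INR (length (lattice d L)) = INR L ^ d.
Proof.
unfold lattice; rewrite grid_length, <- prodd_const.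
now apply prodd_ext; intros i _; rewrite length_map, length_seq.
Qed.

Lemma lattice_disjoint d L r y :
  2 * r < / INR L -> lsum (fun b => chi (near d r y b)) (lattice d L) <= 1.
Proof.
intros Hr.
rewrite (lsum_ext _ (fun p => prodd d (fun i => chi (nrm (y i - p i) <= r))))
  by (intros p _; apply chi_forall_prodd).
unfold lattice; rewrite (grid_sum_prod d _ (fun i v => chi (nrm (y i - v) <= r))).
rewrite <- (pow1 d), <- prodd_const; apply prodd_le; intros i _; split.
- apply lsum_ge0; intros; apply chi_bound.
- rewrite lsum_map; apply sumd_chi_le1.
  intros b c Hb Hc H1 H2; now apply (grid_unique L (y i) r).
Qed.

Lemma lattice_cover d L y :
  (1 <= L)%nat -> exists b, In b (lattice d L) /\ near d (/ (2 * INR L)) y b.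
Proof.
intros HL.
assert (H : exists f : nat -> nat, forall i, (f i < L)%nat /\
              nrm (y i - INR (f i) / INR L) <= / (2 * INR L)).
{ exists (fun i => proj1_sig (constructive_indefinite_description _ (grid_cover L (y i) HL))).
  intros i; apply proj2_sig. }
destruct H as [f Hf].
destruct (grid_In d (fun _ => map (fun b => INR b / INR L) (seq 0 L))
            (fun i => INR (f i) / INR L)) as [p [Hp Hpf]].
- intros i _; apply in_map_iff; exists (f i); split; [easy|].
  apply in_seq; specialize (Hf i); lia.
- exists p; split; [easy|]; intros i Hi; rewrite (Hpf i Hi); apply Hf.
Qed.

(** * Comparison of the Euclidean and sup-norm distances *)

Lemma tdist_eq d x y : tdist d x y = sqrt (sumd d (fun i => Rsqr (nrm (x i - y i)))).
Proof. reflexivity. Qed.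

Lemma nrm_le_tdist d x y i : (i < d)%nat -> nrm (x i - y i) <= tdist d x y.
Proof.
intros Hi; rewrite tdist_eq, <- (sqrt_Rsqr (nrm (x i - y i))) by apply nrm_ge0.
apply sqrt_le_1_alt.
apply (sumd_ge_term d (fun i => Rsqr (nrm (x i - y i)))); [|easy].
intros; apply Rle_0_sqr.
Qed.

Lemma tdist_le d x y : tdist d x y <= sumd d (fun i => nrm (x i - y i)).
Proof.
assert (H0 : forall n, 0 <= sumd n (fun i => nrm (x i - y i))).
{ intros n; apply sumd_ge0; intros; apply nrm_ge0. }
rewrite tdist_eq, <- (sqrt_Rsqr (sumd d (fun i => nrm (x i - y i)))) by apply H0.
apply sqrt_le_1_alt; induction d as [|d IH].
- unfold sumd, Rsqr; simpl; lra.
- rewrite !sumd_S; specialize (H0 d); assert (H1 := nrm_ge0 (x d - y d)).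
  unfold Rsqr in *; nra.
Qed.

Lemma tdist_le_near d r x y : near d r x y -> tdist d x y <= INR d * r.
Proof.
intros H; eapply Rle_trans; [apply tdist_le|].
rewrite <- sumd_const; apply sumd_le, H.
Qed.

Lemma near_tdist d r x y : tdist d x y <= r -> near d r x y.
Proof.
intros H i Hi; eapply Rle_trans; [apply (nrm_le_tdist d x y i Hi)|exact H].
Qed.

Lemma tdist_sym d x y : tdist d x y = tdist d y x.
Proof.
rewrite !tdist_eq; f_equal; apply sumd_ext; intros i _; now rewrite nrm_sym.
Qed.

(** * Equidistribution of dense orbits *)

(** The orbit is kept unreduced: [nrm] ignores integers, and sums of times become plain algebra. *)
Definition orb (x alpha : point) (n : nat) : point := fun i => x i + INR n * alpha i.

Definition dense (d : nat) (alpha : point) : Prop :=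
  forall beta eta, 0 < eta -> exists n, near d eta (fun i => INR n * alpha i) beta.

Lemma orb_add x alpha m n : forall i, orb (orb x alpha m) alpha n i = orb x alpha (m + n) i.
Proof. intros i; unfold orb; rewrite plus_INR; ring. Qed.

Lemma near_orb d r x c alpha n : near d r x c -> near d r (orb x alpha n) (orb c alpha n).
Proof.
intros H i Hi; unfold orb.
replace (x i + _ - _) with (x i - c i) by ring; auto.
Qed.

Lemma uniform_bound {T} (l : list T) (P : T -> nat -> Prop) :
  (forall b, In b l -> exists n, P b n) ->
  exists K, forall b, In b l -> exists n, (n <= K)%nat /\ P b n.
Proof.
induction l as [|b l IH]; intros H; [exists 0%nat; easy|].
destruct IH as [K HK]; [intros; apply H; now right|].
destruct (H b) as [n Hn]; [now left|].
exists (Nat.max n K); intros c [<-|Hc].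
- exists n; split; [lia|easy].
- destruct (HK c Hc) as [m [Hm Hc']]; exists m; split; [lia|easy].
Qed.

(** One [K] bounds the time needed to move the origin near each lattice point, whatever the centre
    and the starting point. [sg = 1] serves [freq_upper]; [sg = -1] serves [freq_lower], which
    carries the cube around [b] back to the centre. *)
Lemma translate_times d alpha eta L sg :
  dense d alpha -> 0 < eta -> exists K, forall b, In b (lattice d L) ->
    exists n, (n <= K)%nat /\ near d eta (fun i => INR n * alpha i) (fun i => sg * b i).
Proof.
intros Ha He; apply uniform_bound; intros b _; apply Ha, He.
Qed.

(* Uniformly in the centre [c], a visit to the ball around [c] is followed
   within bounded time by a visit to (almost) the ball around [c + b], for each
   of the [L ^ d] lattice points [b]. *)
Lemma freq_upper d alpha L r :
  dense d alpha -> (1 <= L)%nat -> 2 * r < / INR L ->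
  exists K : nat, forall c x N,
    sumd N (fun t => chi (near d r (orb x alpha t) c)) <= / INR L ^ d * INR N + INR K.
Proof.
intros Ha HL Hr.
assert (HL' : 1 <= INR L) by (now apply (le_INR 1)).
assert (HLd : 1 <= INR L ^ d) by now apply pow_R1_Rle.
(* Then [2 * (r + eta) < / L]: the enlarged cubes around the lattice points are still disjoint. *)
set (eta := (/ INR L - 2 * r) / 4).
destruct (translate_times d alpha eta L 1 Ha) as [K HK]; [unfold eta; lra|].
exists K; intros c x N.
set (V := sumd N _).
assert (H : forall b, In b (lattice d L) ->
  V <= sumd (N + K) (fun t => chi (near d (r + eta) (orb (fun i => x i - c i) alpha t) b))).
{ intros b Hb; destruct (HK b Hb) as [n [Hn Hnb]].
  apply Rle_trans with (sumd (n + N)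
     (fun t => chi (near d (r + eta) (orb (fun i => x i - c i) alpha t) b))).
  - rewrite sumd_add.
    match goal with |- _ <= ?a + _ =>
      assert (0 <= a) by (apply sumd_ge0; intros; apply chi_bound) end.
    apply Rle_trans with (0 + V); [lra|apply Rplus_le_compat; [easy|]].
    apply sumd_le; intros t _; apply chi_le; intros Hc i Hi.
    specialize (Hnb i Hi); specialize (Hc i Hi); unfold orb in *; rewrite plus_INR.
    replace (x i - c i + (INR n + INR t) * alpha i - b i)
      with (x i + INR t * alpha i - c i + (INR n * alpha i - 1 * b i)) by ring.
    eapply Rle_trans; [apply nrm_add|lra].
  - apply sumd_le_index; [intros; apply chi_bound|lia]. }
(* Sum over [b]: the left side becomes [L^d V], and the right side is at most [N + K], as at each
   time at most one of the disjoint cubes is occupied. *)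
apply lsum_le in H; rewrite lsum_const, lattice_length in H.
assert (H' : INR L ^ d * V <= INR (N + K)).
{ eapply Rle_trans; [exact H|]; rewrite lsum_sumd.
  rewrite <- (Rmult_1_r (INR (N + K))), <- sumd_const; apply sumd_le; intros t _.
  apply lattice_disjoint; unfold eta; lra. }
rewrite plus_INR in H'; assert (0 <= INR K) by apply pos_INR.
apply Rmult_le_reg_l with (INR L ^ d); [lra|].
rewrite Rmult_plus_distr_l, <- Rmult_assoc, Rinv_r, Rmult_1_l by lra; nra.
Qed.

(** Dually, the cubes of radius [/ (2 L)] around the lattice points cover the torus, so each of the
    [N] times falls in one of them; within bounded time each such visit leads to a visit to the ball
    around [c]. *)
Lemma freq_lower d alpha L r :
  dense d alpha -> (1 <= L)%nat -> / INR L < 2 * r ->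
  exists K : nat, forall c x N,
    / INR L ^ d * INR N - INR K <= sumd N (fun t => chi (near d r (orb x alpha t) c)).
Proof.
intros Ha HL Hr.
assert (HL' : 1 <= INR L) by (now apply (le_INR 1)).
assert (HLd : 1 <= INR L ^ d) by now apply pow_R1_Rle.
assert (Hh : / (2 * INR L) = / INR L / 2) by (field; lra).
(* Then [/ (2 L) + eta = r]. *)
set (eta := (2 * r - / INR L) / 2).
destruct (translate_times d alpha eta L (-1) Ha) as [K HK]; [unfold eta; lra|].
exists K; intros c x N.
set (g := fun t => chi (near d r (orb x alpha t) c)).
assert (H : forall b, In b (lattice d L) ->
  sumd N (fun t => chi (near d (/ (2 * INR L)) (orb (fun i => x i - c i) alpha t) b))
  <= sumd N g + INR K).
{ intros b Hb; destruct (HK b Hb) as [n [Hn Hnb]].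
  apply Rle_trans with (sumd (n + N) g).
  - rewrite sumd_add.
    match goal with |- ?b <= ?a + _ => assert (0 <= a) by (apply sumd_ge0; intros; apply chi_bound);
       apply Rle_trans with (0 + b) end; [lra|apply Rplus_le_compat; [easy|]].
    apply sumd_le; intros t _; apply chi_le; intros Hc i Hi.
    specialize (Hnb i Hi); specialize (Hc i Hi); unfold orb in *; rewrite plus_INR.
    replace (x i + (INR n + INR t) * alpha i - c i)
      with (x i - c i + INR t * alpha i - b i + (INR n * alpha i - -1 * b i)) by ring.
    eapply Rle_trans; [apply nrm_add|unfold eta in *; lra].
  - rewrite Nat.add_comm, sumd_add; apply Rplus_le_compat_l.
    apply Rle_trans with (INR n * 1).
    + rewrite <- sumd_const; apply sumd_le; intros; apply chi_bound.
    + rewrite Rmult_1_r; now apply le_INR. }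
apply lsum_le in H; rewrite lsum_const, lattice_length in H.
assert (H' : INR N <= INR L ^ d * (sumd N g + INR K)).
{ eapply Rle_trans; [|exact H]; rewrite lsum_sumd.
  rewrite <- (Rmult_1_r (INR N)), <- sumd_const; apply sumd_le; intros t _.
  destruct (lattice_cover d L (orb (fun i => x i - c i) alpha t) HL) as [b [Hb Hn]].
  rewrite <- (chi_1 _ Hn).
  apply (lsum_ge_term (fun b => chi (near d _ _ b)) _ b); [intros; apply chi_bound|easy]. }
apply Rmult_le_reg_l with (INR L ^ d); [lra|].
rewrite Rmult_minus_distr_l, <- Rmult_assoc, Rinv_r, Rmult_1_l by lra; nra.
Qed.

(** An upper bound [theta] for the integral of [g], phrased with orbits. [K] is independent of the
    starting point [x], because [heavy_packing_bound] restarts the orbit. *)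
Definition visits_le (alpha : point) (g : point -> R) (theta : R) : Prop :=
  exists K, forall x N, sumd N (fun t => g (orb x alpha t)) <= theta * INR N + K.

Lemma visits_le_mono alpha f g th :
  (forall y, f y <= g y) -> visits_le alpha g th -> visits_le alpha f th.
Proof.
intros H [K HK]; exists K; intros x N.
eapply Rle_trans; [apply sumd_le; intros i _; apply H|apply HK].
Qed.

Lemma visits_le_weaken alpha g th th' :
  th <= th' -> visits_le alpha g th -> visits_le alpha g th'.
Proof.
intros H [K HK]; exists K; intros x N; specialize (HK x N).
assert (H0 := pos_INR N); nra.
Qed.

Lemma visits_le_plus alpha f g s t :
  visits_le alpha f s -> visits_le alpha g t -> visits_le alpha (fun y => f y + g y) (s + t).
Proof.
intros [K HK] [K' HK']; exists (K + K'); intros x N.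
specialize (HK x N); specialize (HK' x N); rewrite sumd_lsum in *.
rewrite lsum_plus; lra.
Qed.

Lemma visits_le_lsum {T} alpha (g : T -> point -> R) (th : T -> R) l :
  (forall c, In c l -> visits_le alpha (g c) (th c)) ->
  visits_le alpha (fun y => lsum (fun c => g c y) l) (lsum th l).
Proof.
induction l as [|c l IH]; intros H.
- exists 0; intros x N; unfold lsum; simpl; rewrite sumd_const; lra.
- eapply visits_le_mono; [|apply (visits_le_plus _ (g c) (fun y => lsum (fun c => g c y) l))].
  + intros y; rewrite lsum_cons; apply Rle_refl.
  + apply H; now left.
  + apply IH; intros; apply H; now right.
Qed.

Lemma visits_le_near d alpha L r c :
  dense d alpha -> (1 <= L)%nat -> 2 * r < / INR L ->
  visits_le alpha (fun y => chi (near d r y c)) (/ INR L ^ d).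
Proof.
intros Ha HL Hr; destruct (freq_upper d alpha L r Ha HL Hr) as [K HK].
exists (INR K); intros x N; apply HK.
Qed.

(** * The packing bound *)

(** Two points within [e / (2 d)] of [y] in sup-norm are at Euclidean distance at most
    [d * (e / d) = e], which is less than [2 e]. *)
Lemma packing_disjoint d e n l y :
  (1 <= d)%nat -> 0 < e ->
  (forall i j, (i < n)%nat -> (j < n)%nat -> i <> j ->
      tdist d (nth i l (fun _ => 0)) (nth j l (fun _ => 0)) >= 2 * e) ->
  sumd n (fun j => chi (near d (e / (2 * INR d)) y (nth j l (fun _ => 0)))) <= 1.
Proof.
intros Hd He Hsep; apply sumd_chi_le1; intros i j Hi Hj Hni Hnj.
destruct (Nat.eq_dec i j) as [|Hij]; [easy|exfalso].
assert (Hd' : 1 <= INR d) by now apply (le_INR 1).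
assert (H := Hsep i j Hi Hj Hij).
assert (H' := tdist_le_near d _ _ _ (near_tri d _ _ _ _ _ (near_sym d _ _ _ Hni) Hnj)).
replace (INR d * _) with e in H' by (field; lra); lra.
Qed.

(** [L] is the floor of [d / e] plus one. So [/ L < e / d], as [freq_lower] asks for the radius
    [e / (2 d)], and [L <= 2 d / e] because [d / e > 1]. *)
Lemma scale_ex d e :
  (1 <= d)%nat -> 0 < e < 1 -> exists L, (1 <= L)%nat /\
    / INR L < 2 * (e / (2 * INR d)) /\ INR L ^ d <= (2 * INR d / e) ^ d.
Proof.
intros Hd He; assert (Hd' : 1 <= INR d) by now apply (le_INR 1).
assert (Hde : 1 < INR d / e).
{ apply Rmult_lt_reg_r with e; [lra|].
  replace (INR d / e * e) with (INR d) by (field; lra); lra. }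
destruct (floor_ex (INR d / e)) as [z Hz].
assert (Hz0 : (0 <= z)%Z).
{ assert (-1 < IZR z) by lra; apply lt_IZR in H; lia. }
exists (S (Z.to_nat z)); split; [lia|].
assert (EL : INR (S (Z.to_nat z)) = IZR z + 1).
{ rewrite S_INR, INR_IZR_INZ, Z2Nat.id by easy; ring. }
rewrite EL; split.
- replace (2 * (e / (2 * INR d))) with (/ (INR d / e)) by (field; lra).
  apply Rinv_lt_contravar; [apply Rmult_lt_0_compat; lra|lra].
- apply pow_incr; replace (2 * INR d / e) with (INR d / e + INR d / e) by (field; lra); lra.
Qed.

Lemma linear_le_of_large a b u v : 
  (forall N : nat, a * INR N - u <= b * INR N + v) -> a <= b.
Proof.
intros H; apply Rnot_lt_le; intros Hab.
destruct (INR_unbounded ((u + v) / (a - b))) as [N HN].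
specialize (H N); apply Rmult_lt_compat_r with (r := a - b) in HN; [|lra].
replace ((u + v) / (a - b) * (a - b)) with (u + v) in HN by (field; lra); lra.
Qed.

(** The balls around the packing points are disjoint, so their visits add up: [T] has frequency at
    least [a = n / L^d], with [L] from [scale_ex]. *)
Lemma packing_visits d alpha X e n :
  dense d alpha -> (1 <= d)%nat -> 0 < e < 1 -> packing_ge d X e n ->
  exists T : nat -> Prop, exists a K,
    (forall t, T t -> exists x, X x /\ near d (e / (2 * INR d)) (orb (fun _ => 0) alpha t) x) /\
    (forall N, a * INR N - K <= sumd N (fun t => chi (T t))) /\
    INR n <= (2 * INR d / e) ^ d * a.
Proof.
intros Ha Hd He (l & Hl & HX & Hsep).
destruct (scale_ex d e Hd He) as (L & HL & HLr & HLe).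
assert (HL' : 1 <= INR L) by (now apply (le_INR 1)).
assert (HLd : 1 <= INR L ^ d) by now apply pow_R1_Rle.
set (r := e / (2 * INR d)) in *.
destruct (freq_lower d alpha L r Ha HL HLr) as [K HK].
set (P := fun t j => near d r (orb (fun _ => 0) alpha t) (nth j l (fun _ => 0))).
exists (fun t => exists j, (j < n)%nat /\ P t j), (/ INR L ^ d * INR n), (INR n * INR K).
split; [|split].
- intros t (j & Hj & H); exists (nth j l (fun _ => 0)); split; [|easy].
  apply HX, nth_In; lia.
- intros N.
  apply Rle_trans with (sumd N (fun t => sumd n (fun j => chi (P t j)))).
  + rewrite sumd_swap.
    replace (/ INR L ^ d * INR n * INR N - INR n * INR K)
      with (INR n * (/ INR L ^ d * INR N - INR K)) by ring.
    rewrite <- sumd_const; apply sumd_le; intros j _; apply HK.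
  + apply sumd_le; intros t _.
    destruct (classic (exists j, (j < n)%nat /\ P t j)) as [Ht|Ht].
    * rewrite (chi_1 _ Ht); apply (packing_disjoint d e n l); auto; lra.
    * rewrite (chi_0 _ Ht), <- (Rmult_0_r (INR n)), <- sumd_const.
      apply sumd_le; intros j Hj; rewrite chi_0; [lra|]; intros H; apply Ht; eauto.
- apply Rmult_le_reg_l with (/ (INR L ^ d)); [apply Rinv_0_lt_compat; lra|].
  assert (0 <= / INR L ^ d * INR n).
  { apply Rmult_le_pos; [apply Rlt_le, Rinv_0_lt_compat; lra|apply pos_INR]. }
  rewrite <- Rmult_assoc.
  rewrite <- (Rmult_1_l (/ INR L ^ d * INR n)) at 1.
  apply Rmult_le_compat_r; [easy|].
  apply Rmult_le_reg_l with (INR L ^ d); [lra|].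
  rewrite <- Rmult_assoc, Rinv_r; lra.
Qed.

(** The volume bound for packings, read off a dense orbit: a set of times has frequency at most 1.
    It ensures that packing numbers exist. *)
Lemma packing_trivial d alpha X e n :
  dense d alpha -> (1 <= d)%nat -> 0 < e < 1 -> packing_ge d X e n ->
  INR n <= (2 * INR d / e) ^ d.
Proof.
intros Ha Hd He Hp.
destruct (packing_visits d alpha X e n Ha Hd He Hp) as (T & a & K & _ & HT & Hn).
assert (Hd' : 1 <= INR d) by now apply (le_INR 1).
assert (Ha1 : a <= 1).
{ apply linear_le_of_large with K 0; intros N; eapply Rle_trans; [apply HT|].
  rewrite Rmult_1_l, Rplus_0_r, <- (Rmult_1_r (INR N)), <- sumd_const.
  apply sumd_le; intros; apply chi_bound. }
eapply Rle_trans; [exact Hn|]; rewrite <- (Rmult_1_r ((2 * INR d / e) ^ d)) at 2.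
apply Rmult_le_compat_l; [|easy].
apply pow_le, Rlt_le, Rdiv_lt_0_compat; lra.
Qed.

Lemma packing_number_ex d X e m B :
  packing_ge d X e m -> (forall n, packing_ge d X e n -> INR n <= B) ->
  exists n, (m <= n)%nat /\ packing_number d X e n.
Proof.
intros Hm HB; destruct (INR_unbounded B) as [k Hk].
assert (H : forall j i, packing_ge d X e i -> (k <= i + j)%nat ->
   exists n, (i <= n)%nat /\ packing_number d X e n).
{ induction j as [|j IH]; intros i Hi Hij.
  - exfalso; specialize (HB i Hi); assert (INR k <= INR i) by (apply le_INR; lia); lra.
  - destruct (classic (packing_ge d X e (S i))) as [HS|HS].
    + destruct (IH (S i) HS) as [n [Hn Hp]]; [lia|]; exists n; split; [lia|easy].
    + exists i; split; [lia|now split]. }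
apply (H k m Hm); lia.
Qed.

(** * Strict heaviness and the integer walk *)

Definition thick (d : nat) (A : point -> Prop) (r : R) (y : point) : Prop :=
  exists a, A a /\ near d r y a.

Lemma orbit_orb d alpha x n i :
  (i < d)%nat -> exists z, orbit d alpha x n i = orb x alpha n i + IZR z.
Proof.
intros Hi; induction n as [|n [z Hz]].
- exists 0%Z; unfold orb; simpl; ring.
- unfold orbit in *; simpl; unfold tadd at 1.
  destruct (Nat.ltb_spec i d); [|lia].
  match goal with |- context [frac ?t] => destruct (frac_eq t) as [w ->] end.
  rewrite Hz; exists (z + w)%Z; rewrite plus_IZR; unfold orb; rewrite S_INR; ring.
Qed.

Lemma near_orbit d alpha r x y n :
  near d r y x -> near d r (orb y alpha n) (orbit d alpha x n).
Proof.
intros H i Hi; destruct (orbit_orb d alpha x n i Hi) as [z Hz].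
rewrite nrm_sym, (nrm_eq_mod _ (orb x alpha n i - orb y alpha n i) z) by (rewrite Hz; ring).
rewrite nrm_sym; now apply (near_orb d r y x alpha n).
Qed.

Lemma sumd_chi_nat n (P : nat -> Prop) : exists k : nat, sumd n (fun t => chi (P t)) = INR k.
Proof.
induction n as [|n [k Hk]]; [now exists 0%nat|].
rewrite sumd_S, Hk; destruct (classic (P n)) as [H|H].
- exists (S k); now rewrite S_INR, chi_1.
- exists k; rewrite chi_0 by easy; ring.
Qed.

(** The clause [T l] keeps the last visit at hand, from which the next one gains at least 1. *)
Lemma increasing_count (T : nat -> Prop) (W : nat -> R) N :
  (forall i j, (i < j)%nat -> T i -> T j -> W i + 1 <= W j) ->
  sumd N (fun t => chi (T t)) <= 0 \/
  exists f l, (f <= l < N)%nat /\ T l /\ sumd N (fun t => chi (T t)) <= 1 + W l - W f.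
Proof.
intros HW; induction N as [|N IH]; [left; unfold sumd; simpl; lra|].
rewrite sumd_S; destruct (classic (T N)) as [H|H].
- rewrite chi_1 by easy; right; destruct IH as [IH|(f & l & Hfl & Hl & IH)].
  + exists N, N; split; [lia|]; split; [easy|lra].
  + exists f, N; split; [lia|]; split; [easy|].
    specialize (HW l N ltac:(lia) Hl H); lra.
- rewrite chi_0 by easy; rewrite Rplus_0_r; destruct IH as [IH|(f & l & Hfl & IH)]; [now left|].
  right; exists f, l; split; [lia|easy].
Qed.

(* A point within [r] of a strictly heavy point is strictly heavy for the
   [r]-neighbourhood of [A]; as [p / q <= muA], the integer
   [q S_m - p m] is then at least [1]. *)
Lemma heavy_increment d alpha A muA r p q x y m :
  (0 < q)%nat -> IZR p / INR q <= muA -> (1 <= m)%nat ->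
  heavy_set d A muA alpha x -> near d r y x ->
  1 <= INR q * sumd m (fun t => chi (thick d A r (orb y alpha t))) - IZR p * INR m.
Proof.
intros Hq Hp Hm [_ Hx] Hy; specialize (Hx m Hm).
assert (Hq' : 0 < INR q) by now apply lt_0_INR.
assert (Hm' : 0 < INR m) by now apply lt_0_INR.
assert (E : sumd m (fun i => indicator A (orbit d alpha x i) - muA) =
            sumd m (fun i => chi (A (orbit d alpha x i))) - INR m * muA).
{ transitivity (sumd m (fun i => chi (A (orbit d alpha x i))) + sumd m (fun _ => - muA)).
  (* [indicator A y] and [chi (A y)] are convertible. *)
  - rewrite !sumd_lsum, <- lsum_plus; reflexivity.
  - rewrite sumd_const; ring. }
rewrite E in Hx.
assert (H : sumd m (fun i => chi (A (orbit d alpha x i))) <=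
            sumd m (fun t => chi (thick d A r (orb y alpha t)))).
{ apply sumd_le; intros t _; apply chi_le; intros HA.
  exists (orbit d alpha x t); split; [easy|now apply near_orbit]. }
destruct (sumd_chi_nat m (fun t => thick d A r (orb y alpha t))) as [k Hk].
rewrite Hk in H |- *.
assert (Hp' : IZR p <= muA * INR q).
{ apply Rmult_le_compat_r with (r := INR q) in Hp; [|lra].
  replace (IZR p / INR q * INR q) with (IZR p) in Hp by (field; lra); exact Hp. }
assert (H1 : IZR p * INR m < INR q * INR k) by nra.
rewrite !INR_IZR_INZ, <- !mult_IZR in H1 |- *; rewrite <- minus_IZR.
apply lt_IZR in H1; apply IZR_le; lia.
Qed.

(** Between the times [f] and [l] of [increasing_count], [W] grows by at least the number of visits
    minus one and, by [visits_le] for the orbit started at time [f], by at most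
    [(q theta - p) (l - f) + q K]. Letting [N] grow compares the slopes [a] and [q theta - p]. *)
Lemma heavy_packing_bound d alpha A muA theta e p q n :
  dense d alpha -> (1 <= d)%nat -> 0 < e < 1 -> (0 < q)%nat ->
  IZR p / INR q <= muA -> muA <= theta ->
  visits_le alpha (fun y => chi (thick d A (e / (2 * INR d)) y)) theta ->
  packing_ge d (heavy_set d A muA alpha) e n ->
  INR n <= (2 * INR d / e) ^ d * (INR q * (theta - IZR p / INR q)).
Proof.
intros Ha Hd He Hq Hp Hth [K HK] Hn.
destruct (packing_visits d alpha _ e n Ha Hd He Hn) as (T & a & K' & HT & Hlow & Hna).
assert (Hd' : 1 <= INR d) by now apply (le_INR 1).
assert (Hq' : 0 < INR q) by now apply lt_0_INR.
eapply Rle_trans; [exact Hna|]; apply Rmult_le_compat_l.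
{ apply pow_le, Rlt_le, Rdiv_lt_0_compat; lra. }
replace (INR q * (theta - IZR p / INR q)) with (INR q * theta - IZR p) by (field; lra).
set (r := e / (2 * INR d)) in *.
set (g := fun t => chi (thick d A r (orb (fun _ => 0) alpha t))).
set (W := fun i => INR q * sumd i g - IZR p * INR i).
assert (Hshift : forall i m, sumd (i + m) g - sumd i g =
   sumd m (fun t => chi (thick d A r (orb (orb (fun _ => 0) alpha i) alpha t)))).
{ intros i m; rewrite sumd_add; unfold Rminus; ring_simplify; apply sumd_ext.
  intros t _; unfold g.
  assert (E : forall j, orb (orb (fun _ => 0) alpha i) alpha t j =
                        orb (fun _ => 0) alpha (i + t) j) by apply orb_add.
  apply Rle_antisym; apply chi_le; intros (b & Hb & Hnb); exists b; split; trivial;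
    intros j Hj; specialize (Hnb j Hj); [rewrite E|rewrite <- E]; exact Hnb. }
assert (HW : forall i j, (i < j)%nat -> T i -> T j -> W i + 1 <= W j).
{ intros i j Hij Hi _; destruct (HT i Hi) as (x & Hx & Hnx).
  assert (H := heavy_increment d alpha A muA r p q x _ (j - i) Hq Hp ltac:(lia) Hx Hnx).
  rewrite <- Hshift, minus_INR in H by lia; replace (i + (j - i))%nat with j in H by lia.
  unfold W; lra. }
assert (Hpos : 0 <= INR q * theta - IZR p).
{ apply Rmult_le_compat_l with (r := INR q) in Hp; [|lra].
  replace (INR q * (IZR p / INR q)) with (IZR p) in Hp by (field; lra); nra. }
(* [Rabs K] keeps the constant nonnegative, for the case without visits. *)
apply linear_le_of_large with K' (1 + INR q * Rabs K); intros N.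
eapply Rle_trans; [apply Hlow|].
assert (0 <= (INR q * theta - IZR p) * INR N) by (apply Rmult_le_pos; [easy|apply pos_INR]).
assert (0 <= INR q * Rabs K) by (apply Rmult_le_pos; [lra|apply Rabs_pos]).
destruct (increasing_count T W N HW) as [H'|(f & l & Hfl & _ & H')]; [lra|].
eapply Rle_trans; [exact H'|].
assert (H2 := HK (orb (fun _ => 0) alpha f) (l - f)%nat).
rewrite <- Hshift, minus_INR in H2 by lia; replace (f + (l - f))%nat with l in H2 by lia.
unfold W.
apply Rmult_le_compat_l with (r := INR q) in H2; [|lra].
assert (INR q * K <= INR q * Rabs K) by (apply Rmult_le_compat_l; [lra|apply Rle_abs]).
assert ((INR q * theta - IZR p) * (INR l - INR f) <= (INR q * theta - IZR p) * INR N).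
{ apply Rmult_le_compat_l; [easy|].
  assert (INR l <= INR N) by (apply le_INR; lia); assert (H4 := pos_INR f); lra. }
lra.
Qed.

(** * The neighbourhood of a closed set *)

(** [A] contains canonical representatives only, whereas [orb] is unreduced; membership of a lift
    [y] reads [A (reduce d y)]. *)
Definition reduce (d : nat) (y : point) : point := fun i => if Nat.ltb i d then frac (y i) else 0.

Lemma reduce_in_torus d y : in_torus d (reduce d y).
Proof.
split; intros i Hi; unfold reduce; destruct (Nat.ltb_spec i d); try lia; auto.
apply frac_bound.
Qed.

Lemma reduce_mod d y i : (i < d)%nat -> exists z, reduce d y i = y i + IZR z.
Proof.
intros Hi; unfold reduce; destruct (Nat.ltb_spec i d); [apply frac_eq|lia].
Qed.

Lemma near_reduce_l d r y c : near d r (reduce d y) c <-> near d r y c.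
Proof.
assert (E : forall i, (i < d)%nat -> nrm (reduce d y i - c i) = nrm (y i - c i)).
{ intros i Hi; destruct (reduce_mod d y i Hi) as [z Hz].
  apply (nrm_eq_mod _ _ z); rewrite Hz; ring. }
split; intros H i Hi; specialize (H i Hi); rewrite E in * by easy; exact H.
Qed.

(** On the shortest segment from [a] to [y], the supremum [s] of the parameters of points of [A]
    gives a boundary point, at sup-distance at most [(1 - s) * r] from [y]. *)
Lemma crossing d A r a y :
  (1 <= d)%nat -> (forall x, A x -> in_torus d x) -> torus_closed d A ->
  A a -> in_torus d y -> ~ A y -> near d r y a ->
  exists z, torus_boundary d A z /\ near d r y z.
Proof.
intros Hd HA Hcl Haa Hy Hny Hnear.
assert (Hd' : 1 <= INR d) by now apply (le_INR 1).
assert (Hr : 0 <= r) by (eapply Rle_trans; [apply nrm_ge0|apply (Hnear 0%nat); lia]).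
set (zz := fun i => proj1_sig (constructive_indefinite_description _ (nrm_ex (y i - a i)))).
assert (Hzz : forall i, nrm (y i - a i) = Rabs (y i - a i + IZR (zz i))).
{ intros i; unfold zz; apply proj2_sig. }
set (v := fun i => y i - a i + IZR (zz i)).
assert (Hv : forall i, (i < d)%nat -> Rabs (v i) <= r).
{ intros i Hi; unfold v; rewrite <- Hzz; auto. }
set (gam := fun s => reduce d (fun i => a i + s * v i)).
assert (Hgam : forall s s', near d (Rabs (s - s') * r) (gam s) (gam s')).
{ intros s s'; apply near_reduce_l, near_sym, near_reduce_l; intros i Hi.
  eapply Rle_trans; [apply nrm_le_abs|].
  replace (a i + s' * v i - (a i + s * v i)) with ((s' - s) * v i) by ring.
  rewrite Rabs_mult, (Rabs_minus_sym s'); apply Rmult_le_compat_l; [apply Rabs_pos|auto]. }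
assert (Hgt : forall s s', tdist d (gam s) (gam s') <= INR d * (Rabs (s - s') * r)).
{ intros; apply tdist_le_near, Hgam. }
(* [gam 0] is at distance 0 from [a]; closedness gives membership without an equality of
   functions. *)
assert (Hg0 : A (gam 0)).
{ apply Hcl; [apply reduce_in_torus|]; intros rr Hrr; exists a; split; [easy|].
  eapply Rle_lt_trans; [apply (tdist_le_near d 0)|lra].
  apply near_reduce_l; intros i Hi.
  replace (a i + 0 * v i - a i) with 0 by ring.
  eapply Rle_trans; [apply nrm_le_abs|]; rewrite Rabs_R0; lra. }
assert (Hy1 : near d 0 y (gam 1)).
{ apply near_sym, near_reduce_l; intros i Hi; unfold v.
  rewrite (nrm_eq_mod _ 0 (zz i)) by ring.
  eapply Rle_trans; [apply nrm_le_abs|]; rewrite Rabs_R0; lra. }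
destruct (completeness (fun s => 0 <= s <= 1 /\ A (gam s))) as [s [Hs1 Hs2]].
{ exists 1; intros s [Hs _]; lra. }
{ exists 0; split; [lra|easy]. }
assert (Hs : 0 <= s <= 1).
{ split; [apply Hs1; split; [lra|easy]|apply Hs2; intros u [Hu _]; lra]. }
exists (gam s); split.
- split; [apply reduce_in_torus|]; intros rr Hrr.
  (* [r + 1] keeps the denominator positive when [r = 0]. *)
  set (eta := rr / (2 * INR d * (r + 1))).
  assert (Heta : 0 < eta).
  { apply Rdiv_lt_0_compat; [lra|]; apply Rmult_lt_0_compat; lra. }
  assert (Hclose : forall u, Rabs (s - u) <= eta -> tdist d (gam s) (gam u) < rr).
  { intros u Hu; eapply Rle_lt_trans; [apply Hgt|].
    apply Rle_lt_trans with (INR d * (eta * r)).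
    { apply Rmult_le_compat_l; [lra|]; apply Rmult_le_compat_r; lra. }
    apply Rle_lt_trans with (INR d * (eta * (r + 1))).
    { apply Rmult_le_compat_l; [lra|]; apply Rmult_le_compat_l; lra. }
    replace (INR d * (eta * (r + 1))) with (rr / 2) by (unfold eta; field; lra); lra. }
  split.
  + destruct (classic (exists u, s - eta < u /\ 0 <= u <= 1 /\ A (gam u))) as [(u & Hu & Hu' & HAu)|Hno].
    * exists (gam u); split; [apply reduce_in_torus|]; split; [easy|]; apply Hclose.
      assert (u <= s) by (apply Hs1; now split); rewrite Rabs_right; lra.
    * exfalso; assert (s <= s - eta); [|lra]; apply Hs2; intros u Hu.
      apply Rnot_lt_le; intros Hlt; apply Hno; exists u; tauto.
  + destruct (Rlt_le_dec s 1) as [Hlt|Hge].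
    * set (u := Rmin (s + eta) 1).
      assert (Hu : s < u <= 1 /\ u <= s + eta).
      { unfold u; split; [split|]; [apply Rmin_glb_lt; lra|apply Rmin_r|apply Rmin_l]. }
      exists (gam u); split; [apply reduce_in_torus|]; split.
      -- intros HAu; assert (u <= s); [|lra]; apply Hs1; split; [lra|easy].
      -- apply Hclose; rewrite Rabs_left1; lra.
    (* At [s = 1], [y] itself is the nearby point outside [A], being at distance 0 from [gam 1]. *)
    * exists y; split; [easy|]; split; [easy|].
      assert (s = 1) as -> by lra; rewrite tdist_sym.
      eapply Rle_lt_trans; [apply (tdist_le_near d 0), Hy1|lra].
- apply near_le with (0 + Rabs (1 - s) * r); [|now apply near_tri with (gam 1)].
  rewrite Rabs_right by lra; nra.
Qed.

(** A point at distance at least [2 e] from a maximal packing could be added to it. *)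
Lemma packing_number_cover d X e n :
  packing_number d X e n -> exists l, length l = n /\
    forall z, X z -> exists p, In p l /\ near d (2 * e) z p.
Proof.
intros [(l & Hl & HX & Hsep) Hmax]; exists l; split; [easy|].
intros z Hz; apply NNPP; intros Hno; apply Hmax; exists (z :: l).
split; [simpl; now rewrite Hl|]; split; [intros x [<-|Hx]; auto|].
assert (Hfar : forall j, (j < n)%nat -> tdist d z (nth j l (fun _ => 0)) >= 2 * e).
{ intros j Hj; apply Rnot_lt_ge; intros H; apply Hno.
  exists (nth j l (fun _ => 0)); split; [apply nth_In; lia|].
  apply near_tdist; lra. }
intros [|i] [|j] Hi Hj Hij; simpl; [lia|apply Hfar; lia| |apply Hsep; lia].
rewrite tdist_sym; apply Hfar; lia.
Qed.

(** A point of the neighbourhood outside [A] is within [e] of the boundary by [crossing], hence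
    within [3 e] of a point of a maximal packing of the boundary. The condition [6 * e < / L] bounds
    the frequency of each of these [n] cubes by [L^(-d)]. *)
Lemma visits_le_thick d alpha A e n L theta :
  dense d alpha -> (1 <= d)%nat -> 0 < e ->
  (forall x, A x -> in_torus d x) -> torus_closed d A ->
  packing_number d (torus_boundary d A) e n ->
  (1 <= L)%nat -> 6 * e < / INR L ->
  visits_le alpha (fun y => chi (A (reduce d y))) theta ->
  visits_le alpha (fun y => chi (thick d A (e / (2 * INR d)) y)) (theta + INR n * / INR L ^ d).
Proof.
intros Ha Hd He HA Hcl Hn HL HLe Hth.
assert (Hd' : 1 <= INR d) by now apply (le_INR 1).
destruct (packing_number_cover d _ e n Hn) as (l & Hl & Hcov).
rewrite <- Hl, <- lsum_const.
eapply visits_le_mono; [|apply visits_le_plus; [exact Hth|]].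
2: { apply (visits_le_lsum alpha (fun p y => chi (near d (3 * e) y p))).
     intros p _; apply visits_le_near; auto; lra. }
intros y; cbv beta; set (r := e / (2 * INR d)).
assert (Hr : r <= e).
{ unfold r; apply Rmult_le_reg_r with (2 * INR d); [lra|].
  replace (e / (2 * INR d) * (2 * INR d)) with e by (field; lra); nra. }
assert (H0 : 0 <= lsum (fun p => chi (near d (3 * e) y p)) l).
{ apply lsum_ge0; intros; apply chi_bound. }
destruct (classic (thick d A r y)) as [Hy|Hy].
- rewrite (chi_1 _ Hy); destruct (classic (A (reduce d y))) as [Hr'|Hr'].
  + rewrite (chi_1 _ Hr'); lra.
  + rewrite (chi_0 _ Hr'), Rplus_0_l; destruct Hy as (a & Haa & Hya).
    destruct (crossing d A r a (reduce d y)) as (z & Hz & Hyz); auto.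
    { apply reduce_in_torus. }
    { now apply near_reduce_l. }
    destruct (Hcov z Hz) as (p & Hp & Hzp).
    assert (Hyp : near d (3 * e) y p).
    { apply near_reduce_l, near_le with (r + 2 * e); [lra|]; now apply near_tri with z. }
    rewrite <- (chi_1 _ Hyp).
    apply (lsum_ge_term (fun p => chi (near d (3 * e) y p))); [intros; apply chi_bound|easy].
- rewrite (chi_0 _ Hy); assert (H1 := chi_bound (A (reduce d y))); lra.
Qed.

(* In each coordinate, [a i, b i] is covered by at most [(b i - a i) (L + 1) + 1]
   intervals of length [1 / (L + 1)], slightly less than [1 / L] so that
   [freq_upper] applies to the resulting cubes. *)
Lemma box_cubes d a b eps :
  0 < eps -> exists L l, (1 <= L)%nat /\
    INR (length l) * / INR L ^ d <= box_vol d a b + eps /\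
    forall x, in_box d a b x -> exists c, In c l /\ near d (/ (2 * (INR L + 1))) x c.
Proof.
intros He.
set (w := fun i => Rmax 0 (b i - a i)).
assert (Hw : forall i, 0 <= w i) by (intros; apply Rmax_l).
destruct (prodd_perturb d w eps Hw He) as [t0 [Ht0 Hpert]].
destruct (INR_unbounded (/ t0)) as [L0 HL0].
set (L := S L0).
assert (HL : INR L = INR L0 + 1) by apply S_INR.
assert (H0 : 0 <= INR L0) by apply pos_INR.
(* Floor plus one rather than ceiling: the strict bound [w * (L + 1) < m] leaves a cell for the
   right endpoint. *)
set (m := fun i => S (Z.to_nat (up (w i * (INR L + 1)) - 1))).
assert (Hm : forall i, w i * (INR L + 1) < INR (m i) <= w i * (INR L + 1) + 1).
{ intros i; destruct (archimed (w i * (INR L + 1))) as [Ha Hb].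
  assert (0 <= w i * (INR L + 1)) by (apply Rmult_le_pos; [auto|lra]).
  assert (Hz : (0 < up (w i * (INR L + 1)))%Z) by (apply lt_IZR; lra).
  unfold m; rewrite S_INR, (INR_IZR_INZ (Z.to_nat _)), Z2Nat.id, minus_IZR by lia; lra. }
set (F := fun i => map (fun j => a i + (INR j + / 2) / (INR L + 1)) (seq 0 (m i))).
exists L, (grid d F); split; [unfold L; lia|]; split.
- rewrite grid_length.
  replace (/ INR L ^ d) with ((/ INR L) ^ d) by (apply pow_inv).
  rewrite Rmult_comm, <- prodd_scal.
  eapply Rle_trans; [|apply (Hpert (/ INR L))].
  + apply prodd_le; intros i _; unfold F; rewrite length_map, length_seq; split.
    * apply Rmult_le_pos; [apply Rlt_le, Rinv_0_lt_compat; lra|apply pos_INR].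
    * apply Rmult_le_reg_l with (INR L); [lra|].
      rewrite <- Rmult_assoc, Rinv_r, Rmult_1_l by lra.
      replace (INR L * (w i + (w i + 1) * / INR L)) with (w i * (INR L + 1) + 1)
        by (field; lra); apply Hm.
  + split; [apply Rlt_le, Rinv_0_lt_compat; lra|].
    rewrite <- (Rinv_inv t0); apply Rinv_le_contravar; [now apply Rinv_0_lt_compat|lra].
- intros x Hx.
  assert (Hj : forall i, exists j, (i < d)%nat -> (j < m i)%nat /\
     Rabs (x i - (a i + (INR j + / 2) / (INR L + 1))) <= / (2 * (INR L + 1))).
  { intros i; destruct (floor_ex ((x i - a i) * (INR L + 1))) as [z Hz].
    exists (Z.to_nat z); intros Hi; specialize (Hx i Hi); specialize (Hm i).
    assert (Hwi : b i - a i <= w i) by apply Rmax_r.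
    assert (Hx0 : 0 <= (x i - a i) * (INR L + 1)) by (apply Rmult_le_pos; lra).
    assert (Hz0 : (0 <= z)%Z).
    { assert (-1 < IZR z) by lra; apply lt_IZR in H; lia. }
    split.
    - apply INR_lt; rewrite (INR_IZR_INZ (Z.to_nat z)), Z2Nat.id by easy.
      assert ((x i - a i) * (INR L + 1) <= w i * (INR L + 1)) by (apply Rmult_le_compat_r; lra).
      lra.
    - rewrite (INR_IZR_INZ (Z.to_nat z)), Z2Nat.id by easy.
      apply Rmult_le_reg_l with (INR L + 1); [lra|].
      rewrite <- (Rabs_right (INR L + 1)) at 1 by lra; rewrite <- Rabs_mult.
      replace ((INR L + 1) * (x i - (a i + (IZR z + / 2) / (INR L + 1))))
        with ((x i - a i) * (INR L + 1) - IZR z - / 2) by (field; lra).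
      replace ((INR L + 1) * / (2 * (INR L + 1))) with (/ 2) by (field; lra).
      apply Rabs_le; lra. }
  apply choice in Hj; destruct Hj as [j Hj].
  destruct (grid_In d F (fun i => a i + (INR (j i) + / 2) / (INR L + 1))) as (p & Hp & Hpf).
  + intros i Hi; apply in_map_iff; exists (j i); split; [easy|].
    apply in_seq; specialize (Hj i Hi); lia.
  + exists p; split; [easy|]; intros i Hi; rewrite (Hpf i Hi).
    eapply Rle_trans; [apply nrm_le_abs|]; apply Hj; easy.
Qed.

(** * Compactness of the torus *)

Fixpoint of_Tn (d : nat) : Compactness.Tn d R -> point :=
  match d with
  | O => fun _ _ => 0
  | S d => fun t i => match i with O => fst t | S i => of_Tn d (snd t) i end
  end.

Fixpoint to_Tn (d : nat) (x : point) : Compactness.Tn d R :=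
  match d with
  | O => tt
  | S d => (x 0%nat, to_Tn d (fun i => x (S i)))
  end.

Lemma bounded_to_Tn d a b x :
  (forall i, a <= x i <= b) ->
  Compactness.bounded_n d (to_Tn d (fun _ => a)) (to_Tn d (fun _ => b)) (to_Tn d x).
Proof.
revert x; induction d as [|d IH]; intros x H; simpl; [easy|].
split; [apply H|apply (IH (fun i => x (S i))); intros; apply H].
Qed.

Lemma close_of_Tn d x t r i :
  Compactness.close_n d r (to_Tn d x) t -> (i < d)%nat -> Rabs (x i - of_Tn d t i) < r.
Proof.
revert x t i; induction d as [|d IH]; intros x t i H Hi; [lia|].
destruct t as [t0 t]; simpl in H; destruct H as [H0 H], i as [|i]; simpl; [easy|].
apply (IH (fun i => x (S i))); [easy|lia].
Qed.

(** A bound that is local on a compact space is global. In [visits_le_closed], [P x n] says that the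
    cubes of the box [n] take care of [x]. *)
Lemma torus_locally_bounded d (P : point -> nat -> Prop) :
  (forall t, exists r j, 0 < r /\ forall x, in_torus d x -> near d r x t ->
     exists i, (i <= j)%nat /\ P x i) ->
  exists N, forall x, in_torus d x -> exists i, (i <= N)%nat /\ P x i.
Proof.
intros H; apply choice in H; destruct H as [r Hr].
apply choice in Hr; destruct Hr as [j Hj].
set (delta := fun t => mkposreal (r (of_Tn d t)) (proj1 (Hj (of_Tn d t)))).
(* [compactness_list] yields its finite list under a double negation. *)
apply NNPP; intros Hno.
apply (Compactness.compactness_list d (to_Tn d (fun _ => 0)) (to_Tn d (fun _ => 1)) delta).
intros [l Hl]; apply Hno.
exists (list_max (map (fun t => j (of_Tn d t)) l)); intros x Hx.
destruct (Hl (to_Tn d x)) as (t & Ht & _ & Hxt).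
{ apply bounded_to_Tn; intros i; destruct (Nat.lt_ge_cases i d) as [Hi|Hi].
  - destruct Hx as [Hx _]; specialize (Hx i Hi); lra.
  - destruct Hx as [_ Hx]; rewrite (Hx i Hi); lra. }
destruct (Hj (of_Tn d t)) as [_ Hjt]; destruct (Hjt x Hx) as (i & Hi & HP).
{ intros i Hi; eapply Rle_trans; [apply nrm_le_abs|]; apply Rlt_le.
  exact (close_of_Tn d x t (delta t) i Hxt Hi). }
exists i; split; [|easy].
assert (Hm := proj1 (list_max_le (map (fun t => j (of_Tn d t)) l) _) (Nat.le_refl _)).
rewrite Forall_forall in Hm; specialize (Hm (j (of_Tn d t))).
eapply Nat.le_trans; [exact Hi|apply Hm, in_map_iff]; eauto.
Qed.

Lemma sumd_geom_lt eps N : 0 < eps -> sumd N (fun n => eps * (/ 2) ^ S n) < eps.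
Proof.
intros He.
assert (E : sumd N (fun n => eps * (/ 2) ^ S n) = eps - eps * (/ 2) ^ N).
{ induction N as [|N IH]; [unfold sumd; simpl; ring|].
  rewrite sumd_S, IH; simpl; field. }
rewrite E; assert (0 < (/ 2) ^ N) by (apply pow_lt; lra); nra.
Qed.

(** Each box [n] of the cover is refined into cubes at an extra cost [eps / 2^(n+1)]. By compactness
    the cubes of finitely many boxes suffice, and each is visited with frequency at most its
    [L^(-d)]. *)
Lemma visits_le_closed d alpha A s eps :
  dense d alpha -> (1 <= d)%nat -> torus_closed d A -> cover_bound d A s -> 0 < eps ->
  visits_le alpha (fun y => chi (A (reduce d y))) (s + eps).
Proof.
intros Ha Hd Hcl (a & b & Hcov & Hvol) He.
assert (Hd' : 1 <= INR d) by now apply (le_INR 1).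
assert (Hbc : forall n, exists Ll : nat * list point, (1 <= fst Ll)%nat /\
   INR (length (snd Ll)) * / INR (fst Ll) ^ d <= box_vol d (a n) (b n) + eps * (/ 2) ^ S n /\
   forall x, in_box d (a n) (b n) x ->
     exists c, In c (snd Ll) /\ near d (/ (2 * (INR (fst Ll) + 1))) x c).
{ intros n; destruct (box_cubes d (a n) (b n) (eps * (/ 2) ^ S n)) as (L & l & H).
  - apply Rmult_lt_0_compat; [easy|apply pow_lt; lra].
  - now exists (L, l). }
apply choice in Hbc; destruct Hbc as [Ll HLl].
set (Ln := fun n => INR (fst (Ll n))).
assert (HLn : forall n, 1 <= Ln n) by (intros n; apply (le_INR 1), HLl).
(* Above [/ (2 (L + 1))], so that the enlarged cubes contain neighbourhoods of the original ones;
   below [/ (2 L)], as [visits_le_near] asks. *)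
set (rho := fun n => / (2 * (Ln n + 1)) + (/ (2 * Ln n) - / (2 * (Ln n + 1))) / 2).
assert (Hrho : forall n, / (2 * (Ln n + 1)) < rho n < / (2 * Ln n)).
{ intros n; specialize (HLn n).
  assert (/ (2 * (Ln n + 1)) < / (2 * Ln n)) by (apply Rinv_lt_contravar; nra).
  unfold rho; lra. }
(* Void outside [A], so that compactness of the whole torus applies; around a point outside [A],
   closedness provides a ball that misses [A]. *)
set (P := fun x n => A x -> exists c, In c (snd (Ll n)) /\ near d (rho n) x c).
destruct (torus_locally_bounded d P) as [N HN].
{ intros t; destruct (classic (A (reduce d t))) as [HAt|HAt].
  - destruct (Hcov _ HAt) as [n Hn].
    destruct (HLl n) as (_ & _ & Hc); destruct (Hc _ Hn) as (c & Hcl' & Hnear).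
    exists (rho n - / (2 * (Ln n + 1))), n; specialize (Hrho n); split; [lra|].
    intros x _ Hxt; exists n; split; [lia|]; intros _; exists c; split; [easy|].
    apply near_le with (rho n - / (2 * (Ln n + 1)) + / (2 * (Ln n + 1))); [lra|].
    apply near_tri with t; [easy|]; now apply near_reduce_l.
  - assert (H : exists r, 0 < r /\ ~ exists y, A y /\ tdist d (reduce d t) y < r).
    { apply NNPP; intros Hno; apply HAt, Hcl; [apply reduce_in_torus|].
      intros r Hr; apply NNPP; intros Hno'; apply Hno; now exists r. }
    destruct H as (r & Hr & Hfar).
    exists (r / (2 * INR d)), 0%nat; split; [apply Rdiv_lt_0_compat; lra|].
    intros x _ Hxt; exists 0%nat; split; [lia|]; intros HAx; exfalso; apply Hfar.
    exists x; split; [easy|].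
    eapply Rle_lt_trans; [apply (tdist_le_near d (r / (2 * INR d)))|].
    + now apply near_reduce_l, near_sym.
    + replace (INR d * (r / (2 * INR d))) with (r / 2) by (field; lra); lra. }
apply visits_le_weaken with
  (lsum (fun n => lsum (fun _ => / Ln n ^ d) (snd (Ll n))) (seq 0 (S N))).
{ apply Rle_trans with (lsum (fun n => box_vol d (a n) (b n) + eps * (/ 2) ^ S n) (seq 0 (S N))).
  - apply lsum_le; intros n _; rewrite lsum_const; apply HLl.
  - rewrite lsum_plus; apply Rplus_le_compat; [apply (Hvol (S N))|].
    apply Rlt_le, (sumd_geom_lt eps (S N) He). }
eapply visits_le_mono; [|apply (visits_le_lsum alpha
   (fun n y => lsum (fun c => chi (near d (rho n) y c)) (snd (Ll n))))].
- intros y; cbv beta; destruct (classic (A (reduce d y))) as [Hy|Hy].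
  + rewrite (chi_1 _ Hy).
    destruct (HN (reduce d y) (reduce_in_torus d y)) as (n & Hn & Hc).
    destruct (Hc Hy) as (c & Hcl' & Hnear).
    assert (Hnear' : near d (rho n) y c) by now apply near_reduce_l.
    rewrite <- (chi_1 _ Hnear').
    eapply Rle_trans; [apply (lsum_ge_term (fun c => chi (near d (rho n) y c)) (snd (Ll n)))|].
    * intros; apply chi_bound.
    * exact Hcl'.
    * apply (lsum_ge_term (fun n => lsum (fun c => chi (near d (rho n) y c)) (snd (Ll n)))).
      -- intros; apply lsum_ge0; intros; apply chi_bound.
      -- apply in_seq; lia.
  + rewrite (chi_0 _ Hy); apply lsum_ge0; intros; apply lsum_ge0; intros; apply chi_bound.
- intros n _; apply (visits_le_lsum alpha (fun c y => chi (near d (rho n) y c))).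
  intros c _; apply visits_le_near; [easy|apply HLl|].
  specialize (Hrho n); specialize (HLn n); fold (Ln n).
  replace (/ (2 * Ln n)) with (/ Ln n / 2) in Hrho by (field; lra); lra.
Qed.

(** * Almost every orbit is dense *)

Lemma box_vol_ge0 d a b : 0 <= box_vol d a b.
Proof. apply prodd_ge0; intros; apply Rmax_l. Qed.

Lemma null_set_countable d (X : nat -> point -> Prop) :
  (forall n, null_set d (X n)) -> null_set d (fun x => exists n, X n x).
Proof.
intros HX eps He.
assert (H : forall n, exists ab : (nat -> point) * (nat -> point),
  (forall x, X n x -> exists m, in_box d (fst ab m) (snd ab m) x) /\
  (forall N, sumd N (fun m => box_vol d (fst ab m) (snd ab m)) <= eps * (/ 2) ^ S n)).
{ intros n; destruct (HX n (eps * (/ 2) ^ S n)) as (a & b & H).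
  - apply Rmult_lt_0_compat; [easy|apply pow_lt; lra].
  - now exists (a, b). }
apply choice in H; destruct H as [ab Hab].
set (vol := fun n m => box_vol d (fst (ab n) m) (snd (ab n) m)).
exists (fun k => fst (ab (fst (of_nat k))) (snd (of_nat k))),
       (fun k => snd (ab (fst (of_nat k))) (snd (of_nat k))); split.
- intros x [n Hx]; destruct (Hab n) as [Hc _]; destruct (Hc x Hx) as [m Hm].
  exists (to_nat (n, m)); now rewrite cancel_of_to.
- intros N.
  change (sumd N (fun k => vol (fst (of_nat k)) (snd (of_nat k))) <= eps).
  apply Rle_trans with (lsum (fun q => vol (fst q) (snd q)) (list_prod (seq 0 N) (seq 0 N))).
  (* The pairs coded below [N] are distinct with entries below [N], so their volumes form part of
     the sum over a square. *)
  + rewrite sumd_lsum, <- (lsum_map (fun q => vol (fst q) (snd q)) of_nat).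
    assert (Hincl : incl (map of_nat (seq 0 N)) (list_prod (seq 0 N) (seq 0 N))).
    { intros q Hq; apply in_map_iff in Hq; destruct Hq as (k & <- & Hk).
      apply in_seq in Hk; assert (Hb := to_nat_non_decreasing).
      destruct (of_nat k) as [n m] eqn:E.
      assert (to_nat (n, m) = k) by (rewrite <- E; apply cancel_to_of).
      specialize (Hb n m); apply in_prod; apply in_seq; lia. }
    assert (Hnd : NoDup (map of_nat (seq 0 N))).
    { apply Injective_map_NoDup; [|apply seq_NoDup].
      intros u v Huv; rewrite <- (cancel_to_of u), <- (cancel_to_of v); now f_equal. }
    revert Hincl; generalize (list_prod (seq 0 N) (seq 0 N)) as l2.
    induction (map of_nat (seq 0 N)) as [|q l1 IH]; intros l2 Hincl.
    * apply lsum_ge0; intros; apply box_vol_ge0.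
    * assert (Hq : In q l2) by (apply Hincl; now left).
      apply in_split in Hq; destruct Hq as (m1 & m2 & ->).
      inversion_clear Hnd.
      rewrite lsum_app, !lsum_cons; specialize (IH H0 (m1 ++ m2)).
      rewrite lsum_app in IH; assert (Hi : incl l1 (m1 ++ m2)); [|specialize (IH Hi); lra].
      intros z Hz; assert (Hz' : In z (m1 ++ q :: m2)) by (apply Hincl; now right).
      apply in_app_iff in Hz'; apply in_app_iff.
      destruct Hz' as [Hz'|[<-|Hz']]; [now left|easy|now right].
  + apply Rle_trans with (sumd N (fun n => sumd N (vol n))).
    * right; rewrite sumd_lsum; generalize (seq 0 N) at 1 3 as l; intros l.
      induction l as [|n l IH]; [reflexivity|].
      simpl list_prod; rewrite lsum_app, lsum_map, IH; reflexivity.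
    * eapply Rle_trans; [apply sumd_le; intros n _; apply Hab|].
      now apply Rlt_le, sumd_geom_lt.
Qed.

Lemma cover_bound_list d X (l : list (point * point)) s :
  (1 <= d)%nat ->
  (forall x, X x -> exists B, In B l /\ in_box d (fst B) (snd B) x) ->
  lsum (fun B => box_vol d (fst B) (snd B)) l <= s -> cover_bound d X s.
Proof.
intros Hd Hc Hs.
(* The list is padded with the box from 1 to 0, of volume 0 because [d >= 1]. *)
set (dft := ((fun _ => 1) : point, (fun _ => 0) : point)).
exists (fun n => fst (nth n l dft)), (fun n => snd (nth n l dft)); split.
- intros x Hx; destruct (Hc x Hx) as (B & HB & Hin).
  apply (In_nth _ _ dft) in HB; destruct HB as (n & _ & <-); now exists n.
- intros N; eapply Rle_trans; [|exact Hs].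
  clear Hc Hs; revert l; induction N as [|N IH]; intros l.
  + apply lsum_ge0; intros; apply box_vol_ge0.
  + assert (E : sumd (S N) (fun n => box_vol d (fst (nth n l dft)) (snd (nth n l dft))) =
      box_vol d (fst (nth 0 l dft)) (snd (nth 0 l dft)) +
      sumd N (fun n => box_vol d (fst (nth (S n) l dft)) (snd (nth (S n) l dft)))).
    { change (S N) with (1 + N)%nat; rewrite sumd_add; f_equal; unfold sumd; simpl; ring. }
    rewrite E; destruct l as [|B l].
    * assert (Z : box_vol d (fst dft) (snd dft) = 0).
      { destruct d as [|d]; [lia|]; unfold box_vol; rewrite prodd_S; simpl.
        rewrite Rmax_left by lra; ring. }
      specialize (IH nil).
      rewrite (sumd_ext N _ (fun n => box_vol d (fst (nth n nil dft)) (snd (nth n nil dft))))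
        by (intros [|i] _; reflexivity).
      cbn [nth]; rewrite Z, Rplus_0_l; exact IH.
    * rewrite lsum_cons; apply Rplus_le_compat_l, IH.
Qed.

(* The entries of [L b] are the leading base-[L] digits of [alpha]. *)
Definition leading (d L : nat) (alpha b : point) : Prop :=
  forall i, (i < d)%nat -> b i <= alpha i < b i + / INR L.

Lemma leading_ex d L alpha :
  (1 <= L)%nat -> in_torus d alpha -> exists b, In b (lattice d L) /\ leading d L alpha b.
Proof.
intros HL [Hal _]; assert (HL' : 1 <= INR L) by now apply (le_INR 1).
assert (H : forall i, exists j, (i < d)%nat -> (j < L)%nat /\
  INR j / INR L <= alpha i < INR j / INR L + / INR L).
{ intros i; destruct (floor_ex (INR L * alpha i)) as [z Hz]; exists (Z.to_nat z); intros Hi.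
  specialize (Hal i Hi).
  assert (Hz0 : (0 <= z)%Z).
  { assert (-1 < IZR z) by nra; apply lt_IZR in H; lia. }
  split.
  - apply INR_lt; rewrite (INR_IZR_INZ (Z.to_nat z)), Z2Nat.id by easy; nra.
  - rewrite (INR_IZR_INZ (Z.to_nat z)), Z2Nat.id by easy; split.
    + apply Rmult_le_reg_l with (INR L); [lra|].
      replace (INR L * (IZR z / INR L)) with (IZR z) by (field; lra); lra.
    + apply Rmult_lt_reg_l with (INR L); [lra|].
      replace (INR L * (IZR z / INR L + / INR L)) with (IZR z + 1) by (field; lra); lra. }
apply choice in H; destruct H as [j Hj].
destruct (grid_In d (fun _ => map (fun b => INR b / INR L) (seq 0 L))
            (fun i => INR (j i) / INR L)) as (p & Hp & Hpf).
- intros i Hi; apply in_map_iff; exists (j i); split; [easy|].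
  apply in_seq; specialize (Hj i Hi); lia.
- exists p; split; [easy|]; intros i Hi; rewrite (Hpf i Hi); now apply Hj.
Qed.

(** Multiplication by [L] shifts base-[L] digits: these are the points in whose expansion the digit
    vector [L a] never occurs. *)
Definition avoids (d L : nat) (a alpha : point) : Prop :=
  in_torus d alpha /\
  forall j, ~ leading d L (reduce d (fun i => INR (L ^ j) * alpha i)) a.

Lemma lattice_int d L b i :
  (1 <= L)%nat -> In b (lattice d L) -> (i < d)%nat -> exists k : nat, INR L * b i = INR k.
Proof.
intros HL; assert (HL' : 1 <= INR L) by now apply (le_INR 1).
unfold lattice; revert b; induction d as [|d IH]; intros b Hb Hi; [lia|].
simpl in Hb; apply in_flat_map in Hb; destruct Hb as (p & Hp & Hb).
apply in_map_iff in Hb; destruct Hb as (v & <- & Hv).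
destruct (Nat.eqb_spec i d) as [->|Hid].
- apply in_map_iff in Hv; destruct Hv as (k & <- & _); exists k; field; lra.
- apply IH; [easy|lia].
Qed.

Lemma frac_unique t z : 0 <= t + IZR z < 1 -> frac t = t + IZR z.
Proof.
intros H; destruct (frac_eq t) as [w Hw]; assert (Hb := frac_bound t); rewrite Hw in *.
assert (H1 : -1 < IZR (z - w) < 1) by (rewrite minus_IZR; lra).
destruct H1 as [H1 H2]; apply lt_IZR in H1, H2.
replace z with w by lia; reflexivity.
Qed.

(* Cutting off the leading digit [b <> a] maps the avoiding set into itself, so a
   cover of it yields one with volume multiplied by [(L ^ d - 1) / L ^ d]. *)
Lemma avoids_cover d L a J :
  (1 <= L)%nat -> In a (lattice d L) ->
  exists l : list (point * point),
    (forall x, avoids d L a x -> exists B, In B l /\ in_box d (fst B) (snd B) x) /\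
    lsum (fun B => box_vol d (fst B) (snd B)) l = (1 - / INR L ^ d) ^ J.
Proof.
intros HL Hin; assert (HL' : 1 <= INR L) by now apply (le_INR 1).
assert (HLd : 1 <= INR L ^ d) by now apply pow_R1_Rle.
(* Removing one occurrence of [a] leaves the [L^d - 1] cells allowed to the leading digits. *)
apply in_split in Hin; destruct Hin as (l1 & l2 & Hl12).
assert (Hlen : INR (length (l1 ++ l2)) = INR L ^ d - 1).
{ rewrite <- lattice_length, Hl12, !length_app; simpl; rewrite !plus_INR, S_INR; ring. }
induction J as [|J [l [Hcov Hvol]]].
- exists (((fun _ => 0), (fun _ => 1)) :: nil); split.
  + intros x [[Hx _] _]; exists ((fun _ => 0), (fun _ => 1)); split; [now left|].
    intros i Hi; specialize (Hx i Hi); simpl; lra.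
  + unfold lsum, box_vol; simpl; rewrite prodd_const, Rmax_right by lra.
    rewrite Rminus_0_r, pow1; ring.
- exists (flat_map (fun b : point => map (fun B : point * point =>
       ((fun i => b i + / INR L * fst B i), (fun i => b i + / INR L * snd B i))) l) (l1 ++ l2)).
  split.
  + intros x Hx; destruct (leading_ex d L x HL (proj1 Hx)) as (b & Hb & Hlead).
    set (y := reduce d (fun i => INR L * x i)).
    assert (Hyb : forall i, (i < d)%nat -> y i = INR L * (x i - b i)).
    { intros i Hi; unfold y, reduce; destruct (Nat.ltb_spec i d); [|lia].
      destruct (lattice_int d L b i HL Hb Hi) as [m Hm].
      rewrite (frac_unique _ (- Z.of_nat m)); rewrite opp_IZR, <- INR_IZR_INZ, <- Hm; [ring|].
      specialize (Hlead i Hi).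
      assert (INR L * x i < INR L * (b i + / INR L)) by (apply Rmult_lt_compat_l; lra).
      rewrite Rmult_plus_distr_l, Rinv_r in H0 by lra; nra. }
    assert (Hy : avoids d L a y).
    { split; [apply reduce_in_torus|]; intros j Hj; apply (proj2 Hx (S j)).
      intros i Hi; specialize (Hj i Hi); revert Hj; unfold reduce.
      destruct (Nat.ltb_spec i d); [|lia].
      destruct (reduce_mod d (fun i => INR L * x i) i Hi) as [z Hz]; fold y in Hz.
      rewrite Hz; clear Hz.
      (* Reducing before multiplying by [L^j] changes the product by an integer, so digit [j] of [y]
         is digit [j + 1] of [x]. *)
      match goal with |- ?P -> _ => assert (E : frac (INR (L ^ j) * (INR L * x i + IZR z)) =
         frac (INR (L ^ S j) * x i)) end; [|now rewrite E].
      destruct (frac_eq (INR (L ^ S j) * x i)) as [w Hw].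
      assert (Hb' := frac_bound (INR (L ^ S j) * x i)); rewrite Hw in *.
      rewrite (frac_unique _ (w - Z.of_nat (L ^ j) * z)).
      all: rewrite minus_IZR, mult_IZR, <- INR_IZR_INZ.
      all: simpl Nat.pow in *; rewrite mult_INR in *; lra. }
    destruct (Hcov y Hy) as (B & HB & Hin).
    assert (Hb12 : In b (l1 ++ l2)).
    { rewrite Hl12 in Hb; apply in_app_iff in Hb; apply in_app_iff.
      destruct Hb as [Hb|[<-|Hb]]; [now left| |now right].
      exfalso; apply (proj2 Hx 0%nat); intros i Hi; specialize (Hlead i Hi).
      unfold reduce; destruct (Nat.ltb_spec i d); [|lia].
      destruct (proj1 Hx) as [Hx0 _]; specialize (Hx0 i Hi).
      simpl; rewrite Rmult_1_l, (frac_unique _ 0) by lra; lra. }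
    eexists; split.
    * apply in_flat_map; exists b; split; [exact Hb12|].
      apply in_map_iff; exists B; split; [reflexivity|exact HB].
    * intros i Hi; simpl; specialize (Hin i Hi); rewrite (Hyb i Hi) in Hin.
      split; apply Rmult_le_reg_l with (INR L); try lra;
        rewrite Rmult_plus_distr_l, <- Rmult_assoc, Rinv_r, Rmult_1_l; lra.
  + rewrite lsum_flat_map; transitivity (lsum (fun _ : point =>
        / INR L ^ d * lsum (fun B => box_vol d (fst B) (snd B)) l) (l1 ++ l2)).
    * apply lsum_ext; intros b _; rewrite lsum_map, <- lsum_scal.
      apply lsum_ext; intros B _; unfold box_vol; simpl.
      rewrite <- pow_inv, <- prodd_scal; apply prodd_ext; intros i _.
      rewrite <- RmaxRmult by (apply Rlt_le, Rinv_0_lt_compat; lra); f_equal; ring.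
    * rewrite lsum_const, Hlen, Hvol; simpl; field; lra.
Qed.

Lemma avoids_null d L a :
  (1 <= d)%nat -> (1 <= L)%nat -> In a (lattice d L) ->
  null_set d (avoids d L a).
Proof.
intros Hd HL Hin eps He; assert (HL' : 1 <= INR L) by now apply (le_INR 1).
assert (HLd : 1 <= INR L ^ d) by now apply pow_R1_Rle.
assert (0 < / INR L ^ d <= 1).
{ split; [apply Rinv_0_lt_compat; lra|]; rewrite <- Rinv_1; apply Rinv_le_contravar; lra. }
destruct (pow_lt_1_zero (1 - / INR L ^ d)) with (y := eps) as [J HJ]; auto.
{ rewrite Rabs_right; lra. }
destruct (avoids_cover d L a J HL Hin) as (l & Hc & Hv).
apply (cover_bound_list d _ l eps Hd Hc); rewrite Hv.
specialize (HJ J (le_n J)); apply Rle_trans with (2 := Rlt_le _ _ HJ); apply Rle_abs.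
Qed.

(** Take [/ L <= eta] and let [a] be given by the leading digits of [beta]. Off a countable union of
    null sets, some [L^j alpha] has the same leading digits modulo 1, hence lies within [/ L] of
    [beta]. *)
Lemma almost_every_dense d : (1 <= d)%nat -> almost_every d (dense d).
Proof.
intros Hd.
set (zero := (fun _ => 0) : point).
exists (fun x => exists n, let (L, k) := of_nat n in
  (1 <= L)%nat /\ (k < length (lattice d L))%nat /\ avoids d L (nth k (lattice d L) zero) x).
split.
- apply null_set_countable; intros n; destruct (of_nat n) as [L k].
  destruct (classic ((1 <= L)%nat /\ (k < length (lattice d L))%nat)) as [[HL Hk]|H].
  + intros eps He.
    destruct (avoids_null d L (nth k (lattice d L) zero)) with (eps := eps)
      as (a & b & Hab & Hs); auto.
    { now apply nth_In. }
    exists a, b; split; [|easy]; intros x (_ & _ & Hx); auto.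
  + intros eps He; apply (cover_bound_list d _ nil); auto; [|unfold lsum; simpl; lra].
    intros x Hx; exfalso; tauto.
- intros alpha Hal HN beta eta Heta.
  destruct (INR_unbounded (/ eta)) as [L0 HL0]; set (L := S L0).
  assert (Hinv : 0 < / eta) by now apply Rinv_0_lt_compat.
  assert (HL' : INR L = INR L0 + 1) by apply S_INR.
  assert (HL : (1 <= L)%nat) by (unfold L; lia).
  assert (HLeta : / INR L <= eta).
  { rewrite <- (Rinv_inv eta); apply Rinv_le_contravar; lra. }
  destruct (leading_ex d L (reduce d beta) HL (reduce_in_torus d beta)) as (a & Hin & Hlead).
  apply (In_nth _ _ zero) in Hin; destruct Hin as (k & Hk & Hka).
  assert (Hex : exists j, leading d L (reduce d (fun i => INR (L ^ j) * alpha i)) a).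
  { apply NNPP; intros Hno; apply HN; exists (to_nat (L, k)); rewrite cancel_of_to.
    split; [easy|]; split; [easy|]; rewrite Hka; split; [easy|].
    intros j Hj; apply Hno; eauto. }
  destruct Hex as [j Hj]; exists (L ^ j)%nat.
  apply near_reduce_l, near_sym, near_reduce_l; intros i Hi.
  eapply Rle_trans; [apply nrm_le_abs|].
  specialize (Hj i Hi); specialize (Hlead i Hi); apply Rabs_le; lra.
Qed.

(** * Dimension estimates *)

(** [L] is the floor of [/ (7 e)], where 7 leaves a margin above 6. As [/ (7 e) > 2], the floor is
    at least half of it, whence 14. *)
Lemma coarse_scale_ex e : 0 < e < / 14 ->
  exists L, (1 <= L)%nat /\ 6 * e < / INR L <= 14 * e.
Proof.
intros He.
destruct (floor_ex (/ (7 * e))) as [z Hz].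
assert (H2 : / (14 * e) = / (7 * e) / 2) by (field; lra).
assert (H1 : 1 < / (14 * e)).
{ rewrite <- Rinv_1 at 1; apply Rinv_lt_contravar; lra. }
assert (Hz1 : (1 <= z)%Z).
{ assert (0 < IZR z) by lra; apply lt_IZR in H; lia. }
assert (Hz1' := IZR_le _ _ Hz1).
exists (Z.to_nat z); split; [lia|].
rewrite INR_IZR_INZ, Z2Nat.id by lia; split.
- apply Rlt_le_trans with (7 * e); [lra|].
  rewrite <- (Rinv_inv (7 * e)); apply Rinv_le_contravar; lra.
- rewrite <- (Rinv_inv (14 * e)); apply Rinv_le_contravar; lra.
Qed.

Lemma heavy_packing_le d alpha A muA e p q n m :
  dense d alpha -> (1 <= d)%nat -> 0 < e < / 14 ->
  (forall x, A x -> in_torus d x) -> torus_closed d A -> lebesgue_measure_is d A muA ->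
  (0 < q)%nat -> IZR p / INR q <= muA ->
  packing_number d (torus_boundary d A) e m ->
  packing_ge d (heavy_set d A muA alpha) e n ->
  INR n <= (2 * INR d / e) ^ d * (INR q * (muA - IZR p / INR q + INR m * (14 * e) ^ d)).
Proof.
intros Ha Hd He HA Hcl [_ Hmu] Hq Hp Hm Hn.
assert (Hd' : 1 <= INR d) by now apply (le_INR 1).
assert (Hq' : 0 < INR q) by now apply lt_0_INR.
destruct (coarse_scale_ex e He) as (L & HL & HL1 & HL2).
assert (HL' : 1 <= INR L) by now apply (le_INR 1).
set (C := (2 * INR d / e) ^ d).
assert (HC : 0 < C) by (apply pow_lt, Rdiv_lt_0_compat; lra).
assert (HLd : / INR L ^ d <= (14 * e) ^ d).
{ rewrite <- pow_inv; apply pow_incr; split; [|easy].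
  apply Rlt_le, Rinv_0_lt_compat; lra. }
assert (HLd0 : 0 < / INR L ^ d) by (apply Rinv_0_lt_compat, pow_lt; lra).
assert (Hm0 := pos_INR m).
apply le_epsilon; intros eps Heps.
(* The excess [2 * eps'] over [muA] becomes [eps] after multiplication by [C * q]. *)
set (eps' := eps / (2 * C * INR q)).
assert (HCq : 0 < 2 * C * INR q) by (repeat apply Rmult_lt_0_compat; lra).
assert (Heps' : 0 < eps') by (apply Rdiv_lt_0_compat; lra).
assert (Hs : exists s, s < muA + eps' /\ cover_bound d A s).
{ apply NNPP; intros Hno; assert (muA + eps' <= muA); [|lra]; apply Hmu; intros s Hs.
  apply Rnot_lt_le; intros Hlt; apply Hno; eauto. }
destruct Hs as (s & Hs & Hcov).
assert (Hvis := visits_le_closed d alpha A s eps' Ha Hd Hcl Hcov Heps').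
assert (Hth := visits_le_thick d alpha A e m L _ Ha Hd (proj1 He) HA Hcl Hm HL HL1 Hvis).
apply visits_le_weaken with (th' := muA + 2 * eps' + INR m * (14 * e) ^ d) in Hth.
2: { assert (INR m * / INR L ^ d <= INR m * (14 * e) ^ d) by now apply Rmult_le_compat_l.
     lra. }
assert (0 <= INR m * (14 * e) ^ d) by (apply Rmult_le_pos; lra).
eapply Rle_trans.
{ apply (heavy_packing_bound d alpha A muA (muA + 2 * eps' + INR m * (14 * e) ^ d) e p q n);
    auto; lra. }
fold C; right; unfold eps'; field; lra.
Qed.

(** * Packing numbers at the scale [exp (- T)] *)

Lemma exp_le x y : x <= y -> exp x <= exp y.
Proof. intros [H| ->]; [apply Rlt_le; now apply exp_increasing|lra]. Qed.

Lemma ln_le x y : 0 < x -> x <= y -> ln x <= ln y.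
Proof. intros Hx [H| ->]; [apply Rlt_le; now apply ln_increasing|lra]. Qed.

Lemma exp_pow x n : exp x ^ n = exp (x * INR n).
Proof.
induction n as [|n IH]; [now rewrite Rmult_0_r, exp_0|].
rewrite S_INR, <- tech_pow_Rmult, IH, <- exp_plus; f_equal; ring.
Qed.

Lemma exp_small T : 15 <= T -> 0 < exp (- T) < / 14.
Proof.
intros HT; split; [apply exp_pos|]; rewrite exp_Ropp.
assert (H := exp_ineq1 T ltac:(lra)).
apply Rinv_lt_contravar; lra.
Qed.

Lemma le_exp_of_mink_ratio n T s :
  0 < T -> mink_ratio n (exp (- T)) <= s -> INR n <= exp (T * s).
Proof.
intros HT H; unfold mink_ratio in H; rewrite ln_exp, Ropp_involutive in H.
(* The value of [ln] at 0 carries no information, so [n = 0] is treated apart. *)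
destruct n as [|n]; [apply Rlt_le, exp_pos|].
assert (0 < INR (S n)) by (apply lt_0_INR; lia).
rewrite <- (exp_ln (INR (S n))) by easy.
assert (Hle : ln (INR (S n)) <= T * s).
{ apply Rmult_le_compat_l with (r := T) in H; [|lra].
  replace (T * (ln (INR (S n)) / T)) with (ln (INR (S n))) in H by (field; lra); exact H. }
now apply exp_le.
Qed.

Lemma boundary_packing d alpha X psi delta :
  dense d alpha -> (1 <= d)%nat -> upper_Mdim_is d X psi -> 0 < delta ->
  exists T1, forall T, T1 <= T -> exists m, packing_number d X (exp (- T)) m /\
    INR m <= exp (T * (psi + delta)).
Proof.
intros Ha Hd [Hup _] Hdelta; destruct (Hup delta Hdelta) as (eta & Heta & H).
exists (Rmax 15 (1 - ln eta)); intros T HT.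
assert (HT1 : 15 <= T) by (eapply Rle_trans; [apply Rmax_l|exact HT]).
assert (HT2 : - T < ln eta).
{ assert (1 - ln eta <= T) by (eapply Rle_trans; [apply Rmax_r|exact HT]); lra. }
assert (He := exp_small T HT1).
assert (He' : exp (- T) < eta) by (rewrite <- (exp_ln eta) by easy; now apply exp_increasing).
destruct (packing_number_ex d X (exp (- T)) 0 ((2 * INR d / exp (- T)) ^ d)) as (m & _ & Hm).
- exists nil; split; [easy|]; split; [easy|lia].
- intros n Hn; apply (packing_trivial d alpha X); auto; lra.
- exists m; split; [easy|]; apply le_exp_of_mink_ratio; [lra|].
  apply H; [lra|lra|easy].
Qed.

(** In the boundary term, the factor [e^(-d)] from the disjoint balls cancels against [(14 e)^d].
    [T1] is fixed before [p] and [q], because the irrational case chooses [T] from [q]. *)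
Lemma heavy_packing_exp d alpha A muA psi delta :
  dense d alpha -> (1 <= d)%nat ->
  (forall x, A x -> in_torus d x) -> torus_closed d A -> lebesgue_measure_is d A muA ->
  upper_Mdim_is d (torus_boundary d A) psi -> 0 < delta ->
  exists T1, forall T, T1 <= T -> forall p q n,
    (0 < q)%nat -> IZR p / INR q <= muA ->
    packing_ge d (heavy_set d A muA alpha) (exp (- T)) n ->
    INR n <= (2 * INR d) ^ d * (INR q * ((muA - IZR p / INR q) * exp (T * INR d) +
                                          14 ^ d * exp (T * (psi + delta)))).
Proof.
intros Ha Hd HA Hcl Hmu Hpsi Hdelta.
destruct (boundary_packing d alpha _ psi delta Ha Hd Hpsi Hdelta) as [T1 HT1].
assert (Hd' : 1 <= INR d) by now apply (le_INR 1).
exists (Rmax 15 T1); intros T HT p q n Hq Hp Hn.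
assert (HT15 : 15 <= T) by (eapply Rle_trans; [apply Rmax_l|exact HT]).
destruct (HT1 T) as (m & Hm & Hme); [eapply Rle_trans; [apply Rmax_r|exact HT]|].
assert (Hq' : 0 < INR q) by now apply lt_0_INR.
eapply Rle_trans; [apply (heavy_packing_le d alpha A muA (exp (- T)) p q n m); auto;
                   now apply exp_small|].
assert (E : exp (- T) ^ d = / exp (T * INR d)).
{ rewrite exp_pow, <- exp_Ropp; f_equal; ring. }
assert (HE : 0 < exp (T * INR d)) by apply exp_pos.
unfold Rdiv at 1; rewrite (Rpow_mult_distr (2 * INR d)), (Rpow_mult_distr 14), pow_inv, E, Rinv_inv.
rewrite Rmult_assoc; apply Rmult_le_compat_l; [apply pow_le; lra|].
replace (exp (T * INR d) * (INR q * (muA - IZR p / INR q + INR m * (14 ^ d * / exp (T * INR d)))))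
  with (INR q * ((muA - IZR p / INR q) * exp (T * INR d) + 14 ^ d * INR m)) by (field; lra).
apply Rmult_le_compat_l; [lra|]; apply Rplus_le_compat_l, Rmult_le_compat_l; [|easy].
apply pow_le; lra.
Qed.

(** A lower limit asks only for arbitrarily large [T], and the constant [C] is absorbed by
    [delta / 2] once [T >= 2 * ln C / delta]. *)
Lemma lower_Mdim_bound_exp d alpha X c :
  dense d alpha -> (1 <= d)%nat ->
  (forall delta, 0 < delta -> exists C, 0 < C /\ forall T0, exists T, T0 <= T /\
     forall n, packing_ge d X (exp (- T)) n -> INR n <= C * exp (T * (c + delta))) ->
  lower_Mdim_bound d X c.
Proof.
intros Ha Hd H; destruct (classic (exists x, X x)) as [[x Hx]|Hno].
2: { left; intros x Hx; apply Hno; eauto. }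
right; intros delta eta Hdelta Heta.
destruct (H (delta / 2)) as (C & HC & HT); [lra|].
destruct (HT (Rmax 15 (Rmax (1 - ln eta) (2 * ln C / delta)))) as (T & HT0 & HTn).
assert (H15 : 15 <= T) by (eapply Rle_trans; [apply Rmax_l|exact HT0]).
assert (H' : Rmax (1 - ln eta) (2 * ln C / delta) <= T).
{ eapply Rle_trans; [apply Rmax_r|exact HT0]. }
assert (Heta' : 1 - ln eta <= T) by (eapply Rle_trans; [apply Rmax_l|exact H']).
assert (HCT : 2 * ln C / delta <= T) by (eapply Rle_trans; [apply Rmax_r|exact H']).
assert (He := exp_small T H15).
(* The point [x] makes the packing number at least 1, so that the logarithm of [n] is meaningful. *)
destruct (packing_number_ex d X (exp (- T)) 1 ((2 * INR d / exp (- T)) ^ d)) as (n & Hn & Hpn).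
{ exists (x :: nil); split; [easy|]; split; [intros z [<-|[]]; easy|lia]. }
{ intros n Hn; apply (packing_trivial d alpha X); auto; lra. }
exists (exp (- T)), n; split; [|split; [|split]]; [split| | |].
- apply exp_pos.
- rewrite <- (exp_ln eta) by easy; apply exp_increasing; lra.
- lra.
- easy.
- unfold mink_ratio; rewrite ln_exp, Ropp_involutive.
  assert (Hle : ln (INR n) <= ln C + T * (c + delta / 2)).
  { rewrite <- (ln_exp (T * (c + delta / 2))), <- ln_mult by (auto using exp_pos).
    apply ln_le; [apply lt_0_INR; lia|]; apply HTn, Hpn. }
  apply Rmult_le_reg_l with T; [lra|].
  replace (T * (ln (INR n) / T)) with (ln (INR n)) by (field; lra).
  assert (ln C <= T * (delta / 2)); [|lra].
  apply Rmult_le_compat_r with (r := delta / 2) in HCT; [|lra].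
  replace (2 * ln C / delta * (delta / 2)) with (ln C) in HCT by (field; lra); exact HCT.
Qed.

Lemma fact_multiple m n : (1 <= m <= n)%nat -> exists k, fact n = (k * m)%nat.
Proof.
induction n as [|n IH]; intros Hm; [lia|].
destruct (Nat.eq_dec m (S n)) as [->|Hne].
- exists (fact n); simpl; ring.
- destruct IH as [k Hk]; [lia|]; exists (S n * k)%nat.
  change (fact (S n)) with (S n * fact n)%nat; rewrite Hk; ring.
Qed.

(* With denominators bounded by [Q], the multiples of the fractions by [Q!] are
   distinct integers in a bounded interval. *)
Lemma denominators_unbounded gamma c (p : nat -> Z) (q : nat -> nat) Q :
  (forall i, (0 < q i)%nat) ->
  (forall i j, i <> j -> IZR (p i) / INR (q i) <> IZR (p j) / INR (q j)) ->
  (forall i, 0 <= gamma - IZR (p i) / INR (q i) < c) ->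
  exists i, (Q < q i)%nat.
Proof.
intros Hq Hdist Hg; apply NNPP; intros Hno.
assert (Hb : forall i, (1 <= q i <= Q)%nat).
{ intros i; split; [apply Hq|]; apply Nat.nlt_ge; intros H; apply Hno; eauto. }
assert (Hk : forall i, exists k, fact Q = (k * q i)%nat) by (intros; now apply fact_multiple).
apply choice in Hk; destruct Hk as [k Hk].
assert (HF : 0 < INR (fact Q)) by apply INR_fact_lt_0.
set (f := fun i => (p i * Z.of_nat (k i))%Z).
assert (Hf : forall i, IZR (f i) = INR (fact Q) * (IZR (p i) / INR (q i))).
{ intros i; unfold f; rewrite mult_IZR, <- INR_IZR_INZ, (Hk i), mult_INR.
  assert (0 < INR (q i)) by (apply lt_0_INR, Hq); field; lra. }
destruct (floor_ex (INR (fact Q) * (gamma - c))) as [lo Hlo].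
destruct (floor_ex (INR (fact Q) * gamma)) as [hi Hhi].
assert (Hrange : forall i, (lo <= f i <= hi)%Z).
{ intros i; specialize (Hg i).
  assert (INR (fact Q) * (gamma - c) < IZR (f i) <= INR (fact Q) * gamma).
  { rewrite Hf; split; [apply Rmult_lt_compat_l|apply Rmult_le_compat_l]; lra. }
  assert (Ha : IZR lo < IZR (f i)) by lra; apply lt_IZR in Ha.
  assert (Hb' : IZR (f i) < IZR (hi + 1)) by (rewrite plus_IZR; lra); apply lt_IZR in Hb'; lia. }
set (g := fun i => Z.to_nat (f i - lo)).
set (N := S (Z.to_nat (hi - lo))).
assert (Hlen : (length (map g (seq 0 (S N))) <= length (seq 0 N))%nat).
{ apply NoDup_incl_length.
  - apply Injective_map_NoDup; [|apply seq_NoDup]; intros i j Hij.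
    apply NNPP; intros Hne; apply (Hdist i j Hne).
    assert (Hi := Hrange i); assert (Hj := Hrange j).
    assert (E : f i = f j) by (unfold g in Hij; lia).
    apply Rmult_eq_reg_l with (INR (fact Q)); [|lra]; now rewrite <- !Hf, E.
  - intros z Hz; apply in_map_iff in Hz; destruct Hz as (i & <- & _).
    specialize (Hrange i); apply in_seq; unfold g, N; lia. }
rewrite length_map, !length_seq in Hlen; lia.
Qed.

Lemma almost_every_mono d (P Q : point -> Prop) :
  (forall alpha, P alpha -> Q alpha) -> almost_every d P -> almost_every d Q.
Proof. intros H (N & HN & HP); exists N; auto. Qed.

(** With [q^k = exp (T (d - psi))], both the approximation term [q (c / q^k) exp (T d)] and the
    boundary term [q exp (T psi)] are constant multiples of [exp (T (psi + (d - psi) / k))]: this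
    balance dictates the scale. *)
Lemma lower_Mdim_heavy_irrational d alpha A muA psi k :
  dense d alpha -> (1 <= d)%nat ->
  (forall x, A x -> in_torus d x) -> torus_closed d A -> lebesgue_measure_is d A muA ->
  upper_Mdim_is d (torus_boundary d A) psi -> 1 <= k -> approximable_below muA k ->
  lower_Mdim_bound d (heavy_set d A muA alpha) (psi + (INR d - psi) / k).
Proof.
intros Ha Hd HA Hcl Hmu Hpsi Hk (c & Hc & p & q & Hq & Hdist & Happ).
assert (Hd' : 1 <= INR d) by now apply (le_INR 1).
apply (lower_Mdim_bound_exp d alpha); auto; intros delta Hdelta.
assert (H2d : 0 < (2 * INR d) ^ d) by (apply pow_lt; lra).
(* The scale divides by [d - psi]. If [psi >= d], the claimed bound is at least [d], as [k >= 1],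
   and [packing_trivial] suffices. *)
destruct (Rle_lt_dec (INR d) psi) as [Hle|Hlt].
- exists ((2 * INR d) ^ d); split; [easy|]; intros T0; exists (Rmax 15 T0).
  split; [apply Rmax_r|]; set (T := Rmax 15 T0); intros n Hn.
  assert (HT : 15 <= T) by apply Rmax_l.
  assert (He := exp_small T HT).
  eapply Rle_trans; [apply (packing_trivial d alpha (heavy_set d A muA alpha) (exp (- T)) n); auto; lra|].
  unfold Rdiv at 1; rewrite (Rpow_mult_distr (2 * INR d)), <- exp_Ropp, Ropp_involutive, exp_pow.
  apply Rmult_le_compat_l; [lra|]; apply exp_le, Rmult_le_compat_l; [lra|].
  assert ((psi - INR d) / k <= psi - INR d).
  { apply Rmult_le_reg_r with k; [lra|].
    replace ((psi - INR d) / k * k) with (psi - INR d) by (field; lra); nra. }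
  replace ((INR d - psi) / k) with (- ((psi - INR d) / k)) by (field; lra); lra.
- destruct (heavy_packing_exp d alpha A muA psi delta) as [T1 HT1]; auto.
  assert (H14 : 0 < 14 ^ d) by (apply pow_lt; lra).
  exists ((2 * INR d) ^ d * (c + 14 ^ d)); split; [apply Rmult_lt_0_compat; lra|]; intros T0.
  set (T' := Rmax 0 (Rmax T0 T1)).
  (* Chosen so that [q > Q] forces [T >= T']. *)
  destruct (INR_unbounded (exp (T' * (INR d - psi) / k))) as [Q HQ].
  assert (Hqk : forall i, 1 <= Rpower (INR (q i)) k).
  { intros i; unfold Rpower; rewrite <- exp_0; apply exp_le, Rmult_le_pos; [lra|].
    rewrite <- ln_1; apply ln_le; [lra|]; apply (le_INR 1), Hq. }
  destruct (denominators_unbounded muA c p q Q Hq Hdist) as [i Hi].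
  { intros i; specialize (Happ i); specialize (Hqk i); split; [lra|].
    apply Rlt_le_trans with (1 := proj2 Happ).
    apply Rmult_le_reg_r with (Rpower (INR (q i)) k); [lra|].
    replace (c / Rpower (INR (q i)) k * Rpower (INR (q i)) k) with c by (field; lra); nra. }
  assert (Hqi : 0 < INR (q i)) by now apply lt_0_INR.
  (* The scale [e = exp (- T)] is [q ^ (- k / (d - psi))]. *)
  set (T := k * ln (INR (q i)) / (INR d - psi)).
  assert (Eq : INR (q i) = exp (T * ((INR d - psi) / k))).
  { rewrite <- (exp_ln (INR (q i))) at 1 by easy; f_equal; unfold T; field; lra. }
  assert (Eqk : Rpower (INR (q i)) k = exp (T * (INR d - psi))).
  { unfold Rpower; f_equal; unfold T; field; lra. }
  assert (HT : T' <= T).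
  { apply Rnot_lt_le; intros Hlt'; apply lt_INR in Hi.
    assert (T * ((INR d - psi) / k) <= T' * (INR d - psi) / k); [|apply exp_le in H; lra].
    unfold Rdiv; rewrite Rmult_assoc; apply Rmult_le_compat_r; [|lra].
    apply Rmult_le_pos; [lra|apply Rlt_le, Rinv_0_lt_compat; lra]. }
  assert (HT01 : 0 <= T /\ T0 <= T /\ T1 <= T).
  { assert (H1 := Rmax_l 0 (Rmax T0 T1)); assert (H2 := Rmax_r 0 (Rmax T0 T1)).
    assert (H3 := Rmax_l T0 T1); assert (H4 := Rmax_r T0 T1); fold T' in H1, H2; lra. }
  destruct HT01 as (HTpos & HTT0 & HTT1); exists T; split; [easy|]; intros n Hn.
  specialize (Happ i).
  eapply Rle_trans; [apply (HT1 T HTT1 (p i) (q i) n (Hq i)); [lra|exact Hn]|].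
  rewrite Rmult_assoc; apply Rmult_le_compat_l; [lra|].
  set (E := exp (T * (psi + (INR d - psi) / k + delta))).
  assert (E1 : INR (q i) * (14 ^ d * exp (T * (psi + delta))) = 14 ^ d * E).
  { transitivity (14 ^ d * (INR (q i) * exp (T * (psi + delta)))); [ring|].
    rewrite Eq, <- exp_plus; unfold E; do 2 f_equal; ring. }
  assert (E2 : INR (q i) * ((muA - IZR (p i) / INR (q i)) * exp (T * INR d)) <= c * E).
  { apply Rle_trans with (INR (q i) * (c / Rpower (INR (q i)) k * exp (T * INR d))).
    - apply Rmult_le_compat_l; [lra|]; apply Rmult_le_compat_r; [apply Rlt_le, exp_pos|lra].
    - rewrite Eqk; unfold Rdiv at 1; rewrite <- exp_Ropp.
      apply Rle_trans with (c * exp (T * (psi + (INR d - psi) / k))).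
      + right; transitivity (c * (INR (q i) * exp (- (T * (INR d - psi))) * exp (T * INR d)));
          [ring|].
        rewrite Eq, <- !exp_plus; do 2 f_equal; ring.
      + apply Rmult_le_compat_l; [lra|]; apply exp_le, Rmult_le_compat_l; lra. }
  lra.
Qed.

Lemma lower_Mdim_heavy_rational d alpha A muA psi :
  dense d alpha -> (1 <= d)%nat ->
  (forall x, A x -> in_torus d x) -> torus_closed d A -> lebesgue_measure_is d A muA ->
  upper_Mdim_is d (torus_boundary d A) psi -> is_rational muA ->
  lower_Mdim_bound d (heavy_set d A muA alpha) psi.
Proof.
intros Ha Hd HA Hcl Hmu Hpsi (p & q & Hq & Epq).
assert (Hd' : 1 <= INR d) by now apply (le_INR 1).
apply (lower_Mdim_bound_exp d alpha); auto; intros delta Hdelta.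
destruct (heavy_packing_exp d alpha A muA psi delta) as [T1 HT1]; auto.
exists ((2 * INR d) ^ d * (INR q * 14 ^ d)); split.
{ repeat apply Rmult_lt_0_compat; [apply pow_lt; lra|now apply lt_0_INR|apply pow_lt; lra]. }
intros T0; exists (Rmax T0 T1); split; [apply Rmax_l|]; intros n Hn.
eapply Rle_trans; [apply (HT1 _ (Rmax_r T0 T1) p q n Hq); [lra|exact Hn]|].
right; rewrite Epq; ring.
Qed.

Theorem theorem1 (d : nat) (A : point -> Prop) (muA psi : R) :
  (1 <= d)%nat ->
  (forall x, A x -> in_torus d x) ->
  torus_closed d A ->
  lebesgue_measure_is d A muA ->
  upper_Mdim_is d (torus_boundary d A) psi ->
  (forall k : R, 1 <= k -> ~ is_rational muA -> approximable_below muA k ->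
     almost_every d (fun alpha =>
       lower_Mdim_bound d (heavy_set d A muA alpha) (psi + (INR d - psi) / k))) /\
  (is_rational muA ->
     almost_every d (fun alpha =>
       lower_Mdim_bound d (heavy_set d A muA alpha) psi)).
Proof.
intros Hd HA Hcl Hmu Hpsi; split.
- intros k Hk _ Happ.
  apply almost_every_mono with (2 := almost_every_dense d Hd); intros alpha Ha.
  now apply lower_Mdim_heavy_irrational.
- intros Hrat.
  apply almost_every_mono with (2 := almost_every_dense d Hd); intros alpha Ha.
  now apply lower_Mdim_heavy_rational.
Qed.
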